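(* Let $\mathbb F$ be a finite field with $|\mathbb F|=q$, let $\psi_0:\mathbb F\to\mathbb C^*$ be a non-trivial additive character, let $m\ge 1$, and let $\pi_0$ be an irreducible cuspidal representation of $\mathrm{GL}_{2m}(\mathbb F)$. Then there exists $\gamma(s,\pi_0,\wedge^2,\psi_0)\in\mathbb C(q^{-s})$ such that for every $W_0\in\mathcal W(\pi_0,\psi_0)$ and $\phi_0\in\mathcal S(\mathbb F^m)$, $$\tilde J_{\pi_0,\psi_0}(W_0,\phi_0)+q^{-m(1-s)}\,\mathcal F_{\psi_0}\phi_0(0)\,L(m(1-s),1)\,J_{\pi_0,\psi_0}(W_0,1)=\gamma(s,\pi_0,\wedge^2,\psi_0)\cdot\left(J_{\pi_0,\psi_0}(W_0,\phi_0)+q^{-ms}\,\phi_0(0)\,L(ms,1)\,J_{\pi_0,\psi_0}(W_0,1)\right).$$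
   Context: $L(s,1)=(1-q^{-s})^{-1}$, and in $J_{\pi_0,\psi_0}(W_0,1)$ the symbol $1$ is the constant function $1$ on $\mathbb F^m$. $M=M_m(\mathbb F)$, $G=\mathrm{GL}_m(\mathbb F)$, $\mathcal B\subseteq M$ is the subspace of upper triangular matrices, $N\le G$ the upper triangular unipotent subgroup; $N_{2m}\le\mathrm{GL}_{2m}(\mathbb F)$ is the upper triangular unipotent subgroup, $\psi_0(u)=\psi_0(\sum_iu_{i,i+1})$ for $u\in N_{2m}$. $\mathcal S(\mathbb F^m)$ is the space of all functions $\mathbb F^m\to\mathbb C$ and $\mathcal F_{\psi_0}\phi(y)=q^{-m/2}\sum_{x}\phi(x)\psi_0(\langle x,y\rangle)$ with the standard bilinear form. $\mathcal W(\pi_0,\psi_0)$ is the Whittaker model: the functions $g\mapsto\ell(\pi_0(g)v)$, $v\in V_{\pi_0}$, where $0\ne\ell\in\mathrm{Hom}_{N_{2m}}(\pi_0,\psi_0)$; $\mathrm{GL}_{2m}(\mathbb F)$ acts by right translation. $\tilde W(g)=W(w_{2m}\,{}^tg^{-1})\in\mathcal W(\tilde\pi_0,\psi_0^{-1})$, where $w_{2m}$ is the matrix with ones on the antidiagonal and $\tilde\pi_0$ is the contragredient. $$J_{\pi_0,\psi_0}(W,\phi)=\frac1{[G:N][M:\mathcal B]}\sum_{g\in N\backslash G}\ \sum_{X\in\mathcal B\backslash M}W\left(\sigma_{2m}\begin{pmatrix}I_m&X\\ &I_m\end{pmatrix}\begin{pmatrix}g&\\ &g\end{pmatrix}\right)\psi_0(-\mathrm{tr}X)\,\phi(\varepsilon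 g),$$ where $\varepsilon=(0,\dots,0,1)\in\mathbb F^m$ and $\sigma_{2m}$ is the permutation matrix whose $j$-th column is $e_{\sigma(j)}$, with $\sigma(j)=2j-1$, $\sigma(m+j)=2j$ for $1\le j\le m$. The dual is $\tilde J_{\pi_0,\psi_0}(W,\phi)=J_{\tilde\pi_0,\psi_0^{-1}}\left(\tilde\pi_0\begin{pmatrix}&I_m\\ I_m&\end{pmatrix}\tilde W,\mathcal F_{\psi_0}\phi\right)$. *)

(* Defs.v *)
From HB Require Import structures.
From mathcomp Require Import all_boot all_order all_algebra all_fingroup.
From mathcomp Require Import mxrepresentation complex.
From mathcomp Require Import reals exp trigo.
Set Implicit Arguments.
Unset Strict Implicit.
Unset Printing Implicit Defensive.
Import GroupScope Order.TTheory GRing.Theory Num.Theory.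
Local Open Scope ring_scope.
Local Open Scope complex_scope.

(* The complex numbers are [R[i]] for [R : realType].  Positive integers are
   written [k.+1], so that [{'GL_(k.+1)[F]}] and [{'GL_(k.+1 + k.+1)[F]}] have
   their elements in ['M_k.+1] and ['M_(k.+1 + k.+1)] definitionally. *)

Section ComplexPower.
Variable R : realType.

Definition cpow (a : R) (s : R[i]) : R[i] :=
  (a `^ complex.Re s)%:C
  * (cos (complex.Im s * ln a) +i* sin (complex.Im s * ln a)).

(* [L(s, 1)], for the residue cardinality [q]; meaningful for [q ^ (-s) <> 1]. *)
Definition Lfactor (q : nat) (s : R[i]) : R[i] := (1 - cpow q%:R (- s))^-1.

(* The rational function [f] in [C(T)] is regular at [T = z], with value [v]. *)
Definition ratfun_value (f : {fraction {poly R[i]}}) (z v : R[i]) : Prop :=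
  exists a b : {poly R[i]},
    [/\ b.[z] != 0, f = tofrac a / tofrac b & v = a.[z] / b.[z]].

End ComplexPower.

Section AdditiveCharacter.
Variables (R : realType) (F : finFieldType).

Definition is_addchar (psi : F -> R[i]) : Prop :=
  (forall x, psi x != 0) /\ (forall x y, psi (x + y) = psi x * psi y).

Definition nontrivial_char (psi : F -> R[i]) : Prop := exists x, psi x != 1.

Definition inv_char (psi : F -> R[i]) : F -> R[i] := fun x => (psi x)^-1.

Definition fourier (m : nat) (psi : F -> R[i]) (phi : 'rV[F]_m -> R[i])
    (y : 'rV[F]_m) : R[i] :=
  (#|F|%:R `^ (- (m%:R / 2)))%:C
  * \sum_(x : 'rV[F]_m) phi x * psi ((x *m y^T) 0 0).

End AdditiveCharacter.

Section Unipotents.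
Variable F : finFieldType.

Definition unip (n : nat) : {set {'GL_n[F]}} :=
  [set u : {'GL_n[F]} |
    [forall i : 'I_n.-1.+1, forall j : 'I_n.-1.+1,
       (j <= i)%N ==> ((u : 'M_n.-1.+1) i j == (i == j)%:R)]].

(* Unipotent radical of the standard parabolic of type [(k, n - k)]. *)
Definition unip_radical (n k : nat) : {set {'GL_n[F]}} :=
  [set u : {'GL_n[F]} |
    [forall i : 'I_n.-1.+1, forall j : 'I_n.-1.+1,
       ~~ ((i < k) && (k <= j))%N ==> ((u : 'M_n.-1.+1) i j == (i == j)%:R)]].

Definition upper_triangular (m : nat) : {set 'M[F]_m} :=
  [set X : 'M[F]_m |
    [forall i : 'I_m, forall j : 'I_m, (j < i)%N ==> (X i j == 0)]].

Definition superdiag_sum (n : nat) (A : 'M[F]_n) : F :=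
  \sum_(i < n) \sum_(j < n | j == i.+1 :> nat) A i j.

End Unipotents.

(* A matrix representation [rho] acts on the left on column vectors, by
   [v |-> rho g *m v]; functionals are row vectors. *)
Section Representations.
Variables (R : realType) (F : finFieldType) (n d : nat).
Variable rho : mx_representation R[i] 'GL_n[F] d.

Definition cuspidal : Prop :=
  forall k : nat, (0 < k < n)%N ->
  forall v : 'cV[R[i]]_d,
    (forall u : {'GL_n[F]}, u \in unip_radical F n k -> rho u *m v = v) -> v = 0.

Definition whittaker_functional (psi : F -> R[i]) (ell : 'rV[R[i]]_d) : Prop :=
  forall u : {'GL_n[F]}, u \in unip F n ->
  forall v : 'cV[R[i]]_d,
    (ell *m (rho u *m v)) 0 0 = psi (superdiag_sum u) * (ell *m v) 0 0.

Definition whittaker_model (psi : F -> R[i]) (W : {'GL_n[F]} -> R[i]) : Prop :=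
  exists (ell : 'rV[R[i]]_d) (v : 'cV[R[i]]_d),
    [/\ ell != 0, whittaker_functional psi ell &
        forall g, W g = (ell *m (rho g *m v)) 0 0].

End Representations.

Section Elements.
Variables (F : finFieldType) (k : nat).
Local Notation m := k.+1.

Definition mkGL (n : nat) (A : 'M[F]_n.+1) (uA : A \in unitmx) : {'GL_n.+1[F]} :=
  FinRing.unit 'M[F]_n.+1 uA.

(* 0-indexed version of [sigma(j) = 2j - 1], [sigma(m + j) = 2j]. *)
Definition sigma_fun (j : 'I_(m + m)) : nat :=
  if (j < m)%N then j.*2 else (j - m).*2.+1.

Lemma sigma_fun_lt j : (sigma_fun j < m + m)%N.
Proof.
rewrite /sigma_fun [X in (_ < X)%N]addnn.
case: (ltnP j m) => jm; first by rewrite ltn_double.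
by rewrite ltn_Sdouble ltn_subLR.
Qed.

Definition sigma_ord (j : 'I_(m + m)) : 'I_(m + m) := Ordinal (sigma_fun_lt j).

Lemma sigma_ord_inj : injective sigma_ord.
Proof.
move=> i j /(congr1 val) /= h; apply: val_inj; move: h => /=.
rewrite /sigma_fun; case: ltnP => im; case: ltnP => jm h.
- exact: double_inj.
- by have := congr1 odd h; rewrite /= !odd_double.
- by have := congr1 odd h; rewrite /= !odd_double.
- by case: h => /double_inj h; rewrite -(subnK im) -(subnK jm) h.
Qed.

(* [perm_mx s] has its [i]-th row equal to [e_(s i)], hence the transpose. *)
Definition sigma_mx : 'M[F]_(m + m) := (perm_mx (perm sigma_ord_inj))^T.

Lemma sigma_mx_unit : sigma_mx \in unitmx.
Proof. by rewrite unitmx_tr unitmx_perm. Qed.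

Definition sigmaGL : {'GL_(m + m)[F]} := mkGL sigma_mx_unit.

Definition antidiag_mx (n : nat) : 'M[F]_n := \matrix_(i, j) (i == rev_ord j)%:R.

Lemma antidiag_mx_unit n : antidiag_mx n \in unitmx.
Proof.
have -> : antidiag_mx n = perm_mx (perm (@rev_ord_inj n)).
  apply/matrixP=> i j; rewrite !mxE permE; congr (_%:R); congr (nat_of_bool _).
  by apply/eqP/eqP => [->|<-]; rewrite rev_ordK.
exact: unitmx_perm.
Qed.

Definition antidiagGL : {'GL_(m + m)[F]} := mkGL (antidiag_mx_unit (m + m)).

Definition shear_mx (X : 'M[F]_m) : 'M[F]_(m + m) := block_mx 1%:M X 0 1%:M.

Lemma shear_mx_unit X : shear_mx X \in unitmx.
Proof. by rewrite unitmxE det_ublock !det1 mulr1 unitr1. Qed.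

Definition shearGL (X : 'M[F]_m) : {'GL_(m + m)[F]} := mkGL (shear_mx_unit X).

Definition double_mx (g : {'GL_m[F]}) : 'M[F]_(m + m) :=
  block_mx (g : 'M[F]_m) 0 0 (g : 'M[F]_m).

Lemma double_mx_unit g : double_mx g \in unitmx.
Proof. by rewrite unitmxE det_ublock unitrM -!unitmxE; apply/andP; split; exact: GL_unitmx g. Qed.

Definition doubleGL (g : {'GL_m[F]}) : {'GL_(m + m)[F]} := mkGL (double_mx_unit g).

Definition swap_mx : 'M[F]_(m + m) := block_mx 0 1%:M 1%:M 0.

Lemma swap_mx_unit : swap_mx \in unitmx.
Proof.
have h : swap_mx *m swap_mx = 1%:M.
  by rewrite mulmx_block !mulmx0 !mul0mx !mul1mx ?add0r ?addr0 -scalar_mx_block.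
by have [] := mulmx1_unit h.
Qed.

Definition swapGL : {'GL_(m + m)[F]} := mkGL swap_mx_unit.

Lemma invtr_unit (g : {'GL_(m + m)[F]}) :
  (invmx (g : 'M[F]_(m + m)))^T \in unitmx.
Proof. by rewrite unitmx_tr unitmx_inv; exact: GL_unitmx g. Qed.

Definition invtrGL (g : {'GL_(m + m)[F]}) : {'GL_(m + m)[F]} :=
  mkGL (invtr_unit g).

Definition eps : 'rV[F]_m := delta_mx 0 ord_max.

End Elements.

Section JacquetShalika.
Variables (R : realType) (F : finFieldType) (k : nat).
Local Notation m := k.+1.
Local Notation C := R[i].
Implicit Types (psi : F -> C) (W : {'GL_(m + m)[F]} -> C) (phi : 'rV[F]_m -> C).

Definition rtranslate (h : {'GL_(m + m)[F]}) W : {'GL_(m + m)[F]} -> C :=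
  fun g => W (g * h)%g.

Definition tildeW W : {'GL_(m + m)[F]} -> C :=
  fun g => W (antidiagGL F k * invtrGL g)%g.

(* The cosets of [upper_triangular] are those of the additive group of
   matrices, which is the canonical [finGroupType] of ['M[F]_m].  The summand
   depends only on the cosets when [W] lies in the [psi]-Whittaker model of a
   representation, whence the sum over representatives. *)
Definition JS psi W phi : C :=
  (#|'GL_m[F] : unip F m|%:R * #|[set: 'M[F]_m] : upper_triangular F m|%:R)^-1
  * \sum_(Ng in rcosets (unip F m) 'GL_m[F])
      \sum_(BX in rcosets (upper_triangular F m) [set: 'M[F]_m])
        let g : {'GL_m[F]} := repr Ng in
        let X : 'M[F]_m := repr BX in
        W (sigmaGL F k * shearGL X * doubleGL g)%g
        * psi (- \tr X) * phi (eps F k *m (g : 'M[F]_m)).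

Definition JSdual psi W phi : C :=
  JS (inv_char psi) (rtranslate (swapGL F k) (tildeW W)) (fourier psi phi).

End JacquetShalika.

(* Main.v *)
Require Import Defs.
From HB Require Import structures.
From mathcomp Require Import all_boot all_order all_algebra all_fingroup.
From mathcomp Require Import mxrepresentation complex.
From mathcomp Require Import reals exp trigo.
From mathcomp Require Import zify ring.
Import GroupScope Order.TTheory GRing.Theory Num.Theory.
Local Open Scope ring_scope.
Local Open Scope complex_scope.

Set Implicit Arguments.
Unset Strict Implicit.
Unset Printing Implicit Defensive.

(** The functional equation is a consequence of uniqueness of Whittaker and of
    Shalika functionals, proved here for an irreducible cuspidal representation
    [rho] of [GL_2m] over a finite field.

    Whittaker functionals. A function on [GL_n] that transforms by [psi] under
    the unipotent group [N] on both sides is invariant under reflection in the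
    antidiagonal ([biequivariant_antitr]): by elimination it is determined by
    its values at monomial matrices, and those where it does not vanish are
    fixed by the reflection. As the reflection reverses products, the algebra
    [E End(V) E] is commutative, where [E] is the Whittaker projection, and so [E]
    has rank at most one ([whittaker_proj_rank1]).

    Shalika functionals. At the point mass at the last basis row, [J] is a
    functional that transforms by a character under the subgroup [H] generated
    by the shears [X] and the diagonal copies of the mirabolic subgroup of
    [GL_m]. A nonzero [H]-equivariant vector, once translated by the permutation
    matrix [sigma], has a nonzero Whittaker projection ([shalika_vector_eq0]).
    To see this, decompose the vector under the last column of [N], then the
    previous one, and so on: at odd columns the shears, and at even columns
    cuspidality and the diagonal copies, show that the component at the
    character of [N] is not zero and is equivariant under the part of [H] that
    is still to be used. Since [E] has rank one, every [H]-equivariant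
    functional is a multiple of that given by [J] ([shalika_functional_unique]).

    The two forms. Unfolding the sums over cosets and changing variables by
    [g |-> w g^-T], the dual form becomes the same sum as [J], with the Fourier
    transform of [phi] evaluated in the contragredient orbit. So at the point
    mass at the last basis row both forms give functionals on the same line; let
    [c] be their ratio, which by equivariance is also the ratio at every other
    nonzero vector. At the point mass at zero [J] vanishes and the dual form is
    [q^(-m/2) J(W, 1)]. Thus the dual form is
    [c J(W, phi) + q^(-m/2) phi(0) J(W, 1)] ([JSdual_row_decomp]).

    If [J(W, 1)] vanishes for all [W], the gamma factor is the constant [c].
    Otherwise [J(W, 1)] spans the line of Shalika functionals, which is
    therefore invariant under the whole of [GL_m]; so [J(W, phi)] is the sum of
    the values of [phi] away from zero times one functional, and the vanishing
    of the dual form at [phi = 1] gives [c = - q^(-m/2)]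
    ([JSdual_row_degenerate]). The identity then holds with the rational
    function [q^(m/2) (1 - q^(-ms)) / (q^m q^(-ms) - 1)]. *)

(** * Additive characters and unipotent matrices *)

Section AddChar.
Variables (R : realType) (F : finFieldType) (psi : F -> R[i]).
Hypothesis hpsi : is_addchar psi.

Lemma addchar_neq0 x : psi x != 0.
Proof. exact: hpsi.1. Qed.

Lemma addcharD x y : psi (x + y) = psi x * psi y.
Proof. exact: hpsi.2. Qed.

Lemma addchar0 : psi 0 = 1.
Proof.
by apply: (mulfI (addchar_neq0 0)); rewrite mulr1 -addcharD addr0.
Qed.

Lemma addcharN x : psi (- x) = (psi x)^-1.
Proof.
apply: (mulfI (addchar_neq0 x)).
by rewrite -addcharD subrr addchar0 divff // addchar_neq0.
Qed.

Lemma inv_addchar : is_addchar (inv_char psi).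
Proof.
split=> [x|x y]; rewrite /inv_char; first by rewrite invr_eq0 addchar_neq0.
by rewrite addcharD invfM.
Qed.

Hypothesis hpsi1 : nontrivial_char psi.

Lemma addchar_scale_inj a b : (forall x, psi (a * x) = psi (b * x)) -> a = b.
Proof.
move=> h; apply/eqP; rewrite -subr_eq0; apply/negP=> /negP nz.
case: hpsi1 => x /eqP; apply; rewrite -[x](mulVKf nz).
set y := _^-1 * x; rewrite mulrBl addcharD addcharN -h divff //.
exact: addchar_neq0.
Qed.

(** Translating the summation variable along a coordinate on which [y] does not
    vanish multiplies the sum by a value of [psi] other than [1]. *)
Lemma sum_addchar_row n (y : 'cV[F]_n) :
  \sum_(a : 'rV[F]_n) psi ((a *m y) 0 0) = (y == 0)%:R * #|F|%:R ^+ n.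
Proof.
have [-> | /cV0Pn [i yi]] := eqVneq y 0.
  under eq_bigr do rewrite mulmx0 mxE addchar0.
  by rewrite sumr_const card_mx mul1n natrX mul1r.
rewrite mul0r; case: hpsi1 => x hx.
pose b : 'rV[F]_n := (x / y i 0) *: delta_mx 0 i.
have hb : (b *m y) 0 0 = x.
  by rewrite -scalemxAl mxE -rowE mxE mulfVK.
set S := \sum_a _.
have : S = psi x * S.
  rewrite {1}/S (reindex_inj (addrI b)) /= mulr_sumr; apply: eq_bigr => a _.
  by rewrite mulmxDl mxE hb addcharD.
move/eqP; rewrite -subr_eq0 -{1}[S]mul1r -mulrBl mulf_eq0 subr_eq0 eq_sym.
by rewrite (negPf hx) => /eqP.
Qed.

End AddChar.

Section Unip.
Variables (F : finFieldType) (n : nat).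
Local Notation GL := {'GL_n.+1[F]}.
Local Notation N := (unip F n.+1).
Implicit Types (g h u v : GL).

Lemma GL_eqP g h : (g : 'M_n.+1) = h -> g = h.
Proof. by case: g => A uA; case: h => B uB /= e; apply/val_inj. Qed.

Lemma GLval_unitmx g : (g : 'M_n.+1) \in unitmx.
Proof. exact: GL_unitmx g. Qed.

Lemma mem_GL g : g \in 'GL_n.+1[F].
Proof. by rewrite inE. Qed.

Lemma unipP u :
  reflect (forall i j : 'I_n.+1, (j <= i)%N -> (u : 'M_n.+1) i j = (i == j)%:R)
          (u \in N).
Proof.
rewrite inE; apply: (iffP forallP) => h i.
  by move=> j ji; have /forallP/(_ j)/implyP/(_ ji)/eqP := h i.
by apply/forallP=> j; apply/implyP=> ji; rewrite h.
Qed.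

Lemma unip1 : 1%g \in N.
Proof. by apply/unipP => i j _; rewrite GL_1E mxE. Qed.

Lemma unip_mulmx u (A : 'M[F]_n.+1) i j : u \in N ->
  (u *m A) i j = A i j + \sum_(l < n.+1 | (i < l)%N) (u : 'M_n.+1) i l * A l j.
Proof.
move/unipP=> hu; rewrite mxE (bigID (fun l : 'I_n.+1 => (l <= i)%N)) /=.
congr (_ + _); last by apply: eq_bigl => l; rewrite -ltnNge.
rewrite (bigD1 i) //= hu // eqxx mul1r big1 ?addr0 // => l /andP[li nli].
by rewrite hu // eq_sym (negPf nli) mul0r.
Qed.

Lemma unipM u v : u \in N -> v \in N -> (u * v)%g \in N.
Proof.
move=> hu /unipP hv; apply/unipP => i j ji.
rewrite GL_MxE -/(mulmx _ _) unip_mulmx // hv // big1 ?addr0 // => l il.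
by rewrite hv ?(leq_trans ji (ltnW il)) // -val_eqE gtn_eqF ?mulr0 // (leq_ltn_trans ji).
Qed.

Lemma group_set_unip : group_set N.
Proof. by apply/group_setP; split=> [|u v]; [exact: unip1|exact: unipM]. Qed.

Canonical unip_group := Group group_set_unip.

Lemma superdiag_sum_unipM u v : u \in N -> v \in N ->
  superdiag_sum ((u * v)%g : GL) = superdiag_sum u + superdiag_sum v.
Proof.
move=> hu /unipP hv; rewrite GL_MxE /superdiag_sum -big_split /=.
apply: eq_bigr => i _; rewrite -big_split /=; apply: eq_bigr => j /eqP ji.
rewrite unip_mulmx // addrC; congr (_ + _).
rewrite (bigD1 j) /=; last by rewrite ji.
rewrite hv // eqxx mulr1 big1 ?addr0 // => l /andP[il nl].
by rewrite hv ?ji // (negPf nl) mulr0.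
Qed.

Lemma superdiag_sum_unip1 : superdiag_sum (1%g : GL) = 0.
Proof.
rewrite /superdiag_sum big1 // => i _; rewrite big1 // => j /eqP ij.
by rewrite GL_1E mxE; case: eqP => // e; move: ij; rewrite e => /eqP; rewrite ltn_eqF.
Qed.

Lemma superdiag_sum_unipV u : u \in N ->
  superdiag_sum ((u^-1)%g : GL) = - superdiag_sum u.
Proof.
move=> hu; apply/eqP; rewrite -addr_eq0 -superdiag_sum_unipM ?groupV //.
by rewrite mulVg superdiag_sum_unip1.
Qed.

End Unip.

(** * Permutations all of whose unit descents are adjacent *)

Section UnitDescents.
Variables (n : nat) (T : eqType) (t : 'I_n -> 'I_n) (c : 'I_n -> T).
Hypothesis t_inj : injective t.
Hypothesis t_desc : forall i j : 'I_n, (i < j)%N ->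
  (t j).+1 = t i -> j = i.+1 :> nat /\ c j = c i.

(** The value just below [t j] is attained after [j], because [t] preserves the
    indices below [i] and the larger values are already placed; the hypothesis
    on unit descents then says that it is attained at [j + 1]. *)
Lemma reversed_block (i : 'I_n) :
  (forall j : 'I_n, (t j < i)%N = (j < i)%N) ->
  forall e, (i + e <= t i)%N -> forall j : 'I_n, (i <= j <= i + e)%N ->
    (t j + j = t i + i)%N /\ c j = c i.
Proof.
move=> stab; elim=> [|e IH] le j jie.
  by have -> : j = i by apply/val_inj => /=; lia.
have {}IH := IH ltac:(lia).
have [je|je] := leqP j (i + e); first by apply: IH; lia.
have lt0 : (i + e < n)%N by have := ltn_ord j; lia.
have [/= t0 c0] := IH (Ordinal lt0) ltac:(rewrite /=; lia).
have ltw : (t i - e.+1 < n)%N by have := ltn_ord (t i); lia.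
have [ti tiK tKi] := injF_bij t_inj.
pose p := ti (Ordinal ltw).
have tp : t p = (t i - e.+1)%N :> nat by rewrite /p tKi.
have ip : (i <= p)%N by rewrite leqNgt -stab tp; lia.
have pe : (i + e < p)%N.
  by rewrite ltnNge; apply/negP => pe; have [] := IH p ltac:(lia); lia.
have [/= pE cp] := @t_desc (Ordinal lt0) p pe ltac:(lia).
have -> : j = p by apply: val_inj => /=; lia.
by rewrite cp c0; split=> //; lia.
Qed.

(** Peeling off one block at a time: [t] reverses the block of indices between
    [i] and [t i] as soon as it preserves the indices below [i]. *)
Lemma reversed_involution : forall i, t (t i) = i /\ c (t i) = c i.
Proof.
suff H N : exists2 b : nat, (N <= b)%N & forall j : 'I_n, (t j < b)%N = (j < b)%N /\
   ((j < b)%N -> t (t j) = j /\ c (t j) = c j).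
  by move=> i; have [b /[dup] nb _ /(_ i) [_]] := H n; apply; have := ltn_ord i; lia.
elim: N => [|N [b Nb Hb]]; first by exists 0%N.
have [nb|bn] := leqP n b.
  by exists b.+1 => [|j]; rewrite ?ltnS // !(leq_trans (ltnW (ltn_ord _)) nb);
     split=> // _; apply (Hb j); exact: leq_trans (ltn_ord _) nb.
have [i ib] : exists i : 'I_n, b = i by exists (Ordinal bn).
move: bn Nb Hb; rewrite {b}ib => _ Nb Hb.
have stab (j : 'I_n) : (t j < i)%N = (j < i)%N by have [] := Hb j.
have iti : (i <= t i)%N by rewrite leqNgt stab ltnn.
have blk (j : 'I_n) : (i <= j <= t i)%N -> (t j + j = t i + i)%N /\ c j = c i.
  by move=> ji; apply: (@reversed_block i stab (t i - i)); lia.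
have bwd (j : 'I_n) : (t j <= t i)%N -> (j <= t i)%N.
  have [//|tij] := leqP j (t i) => tji.
  have [tjb|btj] := ltnP (t j) i; first by move: tjb; rewrite stab; lia.
  have lt0 : (t i + i - t j < n)%N by have := ltn_ord (t i); lia.
  have [/= + _] := blk (Ordinal lt0) ltac:(rewrite /=; lia).
  move=> e; suff : j = Ordinal lt0 by move/(congr1 val) => /=; lia.
  by apply: t_inj; apply: val_inj => /=; lia.
exists (t i).+1; first by lia.
move=> j; rewrite !ltnS; split.
  apply/idP/idP; first exact: bwd.
  move=> jti; have [ji|ij] := ltnP j i; first by have := stab j; lia.
  by have [] := blk j ltac:(lia); lia.
move=> jti; have [ji|ij] := ltnP j i; first by apply (Hb j).
have [e1 c1] := blk j ltac:(lia).
have [e2 c2] := blk (t j) ltac:(lia).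
by rewrite c1 c2; split=> //; apply: val_inj => /=; lia.
Qed.
End UnitDescents.

(** * Rank one matrices and the Bruhat decomposition *)

Section RankOne.
Variables (F : finFieldType) (n : nat).
Local Notation GL := {'GL_n.+1[F]}.

(** Total on matrices, so that group elements can be written without carrying
    proofs of invertibility; the value is junk off the invertible matrices. *)
Definition GLof (A : 'M[F]_n.+1) : GL :=
  if @idP (A \in unitmx) is ReflectT uA then mkGL uA else 1%g.

Lemma val_GLof A : A \in unitmx -> GLval (GLof A) = A.
Proof. by rewrite /GLof => uA; case: {-}_ / idP. Qed.

Lemma rank1_unit (x : 'cV[F]_n.+1) (y : 'rV[F]_n.+1) :
  1 + (y *m x) 0 0 != 0 -> 1%:M + x *m y \in unitmx.
Proof.
set b := (y *m x) 0 0 => nz.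
have yx : y *m x = b%:M by rewrite [LHS]mx11_scalar.
have h : (1%:M + x *m y) *m (1%:M - (1 + b)^-1 *: (x *m y)) = 1%:M.
  rewrite mulmxDl mul1mx mulmxBr mulmx1 -scalemxAr mulmxA -(mulmxA x) yx.
  rewrite mul_mx_scalar -scalemxAl scalerA.
  move: (x *m y) => A; apply/matrixP=> i j; rewrite !mxE.
  move: (A i j) (_%:R) => e f; field; exact: nz.
by have [] := mulmx1_unit h.
Qed.

Definition rank1 (x : 'cV[F]_n.+1) (y : 'rV[F]_n.+1) := GLof (1%:M + x *m y).

Lemma val_rank1 x y : (y *m x) 0 0 = 0 -> GLval (rank1 x y) = 1%:M + x *m y.
Proof. by move=> yx; rewrite val_GLof // rank1_unit // yx addr0 oner_eq0. Qed.

Lemma rank1_unip (x : 'cV[F]_n.+1) (y : 'rV[F]_n.+1) :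
  (forall i j : 'I_n.+1, (j <= i)%N -> x i 0 * y 0 j = 0) -> 
  GLval (rank1 x y) = 1%:M + x *m y /\ rank1 x y \in unip F n.+1.
Proof.
move=> xy0; have v : GLval (rank1 x y) = 1%:M + x *m y.
  by apply: val_rank1; rewrite mxE big1 // => i _; rewrite mulrC xy0.
split=> //; apply/unipP => i j ji.
by rewrite v !mxE big_ord1 xy0 // addr0.
Qed.

Lemma rank1_mulE (x : 'cV[F]_n.+1) (y : 'rV[F]_n.+1) (A : 'M_n.+1) i j :
  ((1%:M + x *m y) *m A) i j = A i j + x i 0 * (y *m A) 0 j.
Proof. by rewrite mulmxDl mul1mx -mulmxA !mxE big_ord1 mxE. Qed.

Lemma mulE_rank1 (x : 'cV[F]_n.+1) (y : 'rV[F]_n.+1) (A : 'M_n.+1) i j :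
  (A *m (1%:M + x *m y)) i j = A i j + (A *m x) i 0 * y 0 j.
Proof. by rewrite mulmxDr mulmx1 mulmxA !mxE big_ord1 mxE. Qed.

Lemma superdiag_sum_rank1 (x : 'cV[F]_n.+1) (y : 'rV[F]_n.+1) :
  superdiag_sum (1%:M + x *m y) =
  \sum_(i < n.+1) \sum_(j < n.+1 | j == i.+1 :> nat) x i 0 * y 0 j.
Proof.
apply: eq_bigr => i _; apply: eq_bigr => j /eqP ji.
by rewrite !mxE big_ord1 -val_eqE /= ji ltn_eqF // add0r.
Qed.

Definition transv (i j : 'I_n.+1) (x : F) : GL := 
  rank1 (x *: delta_mx i 0) (delta_mx 0 j).

Lemma transvP (i j : 'I_n.+1) x : (i < j)%N -> [/\ transv i j x \in unip F n.+1,
  GLval (transv i j x) = 1%:M + (x *: delta_mx i 0 : 'cV_n.+1) *m delta_mx 0 j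
  & superdiag_sum (transv i j x) = (j == i.+1 :> nat)%:R * x].
Proof.
move=> ij; have [|v u] := @rank1_unip (x *: delta_mx i 0) (delta_mx 0 j).
  move=> i' j' ji'; rewrite !mxE !eqxx !andbT /=.
  case: eqP => [e1|]; last by rewrite mulr0 mul0r.
  case: eqP => [e2|]; last by rewrite mulr0.
  by move: ij; rewrite -e1 -e2 ltnNge ji'.
rewrite /transv v; split=> //; rewrite superdiag_sum_rank1.
rewrite (bigD1 i) //= [X in _ + X]big1 ?addr0 => [|i' ni]; last first.
  by apply: big1 => j' _; rewrite !mxE (negPf ni) mulr0 mul0r.
case: eqP => [ji|ji].
  rewrite (bigD1 j) /=; last by apply/eqP.
  rewrite big1 ?addr0 => [|j' /andP[_ nj]]; first by rewrite !mxE !eqxx !mulr1 mul1r.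
  by rewrite !mxE (negPf nj) mulr0.
rewrite big1 ?mul0r // => j' /eqP j'i; rewrite !mxE.
by case: (j' =P j) => [e|_]; rewrite ?andbF ?mulr0 //; case: ji; rewrite -e.
Qed.

End RankOne.

Section Bruhat.
Variables (F : finFieldType) (n : nat).
Local Notation GL := {'GL_n.+1[F]}.
Local Notation N := (unip F n.+1).
Implicit Types (A B : 'M[F]_n.+1) (g u v : GL) (i j : 'I_n.+1).

Definition cross A i j := [&& A i j != 0, [forall l, (l != i) ==> (A l j == 0)]
  & [forall l, (l != j) ==> (A i l == 0)]].

Lemma crossP A i j : reflect [/\ A i j != 0, forall l, l != i -> A l j = 0
  & forall l, l != j -> A i l = 0] (cross A i j).
Proof.
apply: (iffP and3P) => -[h1 h2 h3]; split=> //.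
- by move=> l nl; have /forallP/(_ l)/implyP/(_ nl)/eqP := h2.
- by move=> l nl; have /forallP/(_ l)/implyP/(_ nl)/eqP := h3.
- by apply/forallP=> l; apply/implyP=> nl; rewrite h2.
- by apply/forallP=> l; apply/implyP=> nl; rewrite h3.
Qed.

Definition crossed A : {set 'I_n.+1} := [set j | [exists i, cross A i j]].

Lemma crossedP A j : reflect (exists i, cross A i j) (j \in crossed A).
Proof. by rewrite inE; exact: existsP. Qed.

Lemma GL_col_neq0 g j : exists i, (g : 'M_n.+1) i j != 0.
Proof.
apply/existsP; rewrite -[X in is_true X]negbK negb_exists; apply/negP=> /forallP h.
have : GLval g *m (delta_mx j 0 : 'cV_n.+1) = 0.
  by apply/colP=> i; rewrite -colE !mxE; apply/eqP; have := h i; rewrite negbK.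
move/(congr1 (mulmx (invmx g))); rewrite mulKmx ?GLval_unitmx // mulmx0.
by move/colP/(_ j)/eqP; rewrite !mxE !eqxx oner_eq0.
Qed.

(** One step of elimination: in the first uncrossed column, the lowest nonzero
    entry becomes a pivot. Upward row operations and rightward column operations
    clear the rest of its column and row without spoiling earlier crosses. *)
Lemma crossed_proper g : crossed g != setT ->
  exists u v, [/\ u \in N, v \in N & crossed g \proper crossed ((u * g * v)%g : GL)].
Proof.
rewrite -subTset => /subsetPn[j0 _ j0n].
case: (@arg_minnP _ j0 [pred j | j \notin crossed g] val) => //= j jn jmin.
have [i0 i0n] := GL_col_neq0 g j.
case: (@arg_maxnP _ i0 [pred i | (g : 'M_n.+1) i j != 0] val) => //= i gij imax.
pose x : 'cV[F]_n.+1 := \col_p (if p == i then 0 else - GLval g p j / GLval g i j).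
pose z : 'rV[F]_n.+1 := \row_q (if q == j then 0 else - GLval g i q / GLval g i j).
have cr i1 q : cross g i1 q -> [/\ i1 != i, q != j, GLval g i1 j = 0 & GLval g i q = 0].
  move=> c1; have qj : q != j by apply: contraNneq jn => <-; apply/crossedP; exists i1.
  have [h1 h2 h3] := crossP _ _ _ c1.
  have e1 : GLval g i1 j = 0 by apply: h3; rewrite eq_sym.
  have i1i : i1 != i by apply: contraNneq gij => <-; rewrite e1.
  by split=> //; apply: h2; rewrite eq_sym.
have [|ue un] := @rank1_unip _ _ x (delta_mx 0 i).
  move=> p q qp; rewrite !mxE eqxx /=; case: (q =P i) => [qi|]; last by rewrite mulr0.
  case: (p =P i) => [_|/eqP pi]; first by rewrite mul0r.
  have [-> |pj] := eqVneq (GLval g p j) 0; first by rewrite oppr0 !mul0r.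
  have := imax p pj; rewrite leq_eqVlt val_eqE (negPf pi) /= => lt.
  by move: qp; rewrite qi leqNgt lt.
have [|ve vn] := @rank1_unip _ _ (delta_mx j 0) z.
  move=> p q qp; rewrite !mxE eqxx andbT; case: (p =P j) => [pj|]; last by rewrite mul0r.
  case: (q =P j) => [_|/eqP qj]; first by rewrite mulr0.
  have [/crossedP[i1 /cr[_ _ _ ->]]|qn] := boolP (q \in crossed g).
    by rewrite oppr0 mul0r mulr0.
  have := jmin q qn; rewrite leq_eqVlt eq_sym val_eqE (negPf qj) /= => lt.
  by move: qp; rewrite pj leqNgt lt.
set u := rank1 x _ in ue un; set v := rank1 _ z in ve vn.
have B p q : GLval (u * g * v)%g p q = if p == i then (if q == j then GLval g i j else 0)
    else GLval g p q - GLval g p j / GLval g i j * GLval g i q.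
  rewrite !GL_MxE ue ve mulE_rank1 -colE [col _ _ _ _]mxE !rank1_mulE -rowE !mxE.
  case: (eqVneq p i) => [->|pi]; case: (eqVneq q j) => [->|qj]; by field.
exists u, v; split=> //; apply/properP; split; last first.
  exists j => //; apply/crossedP; exists i; apply/crossP.
  split=> [|l li|l lj]; rewrite B ?eqxx //.
    by rewrite (negPf li) divfK // subrr.
  by rewrite (negPf lj).
apply/subsetP=> q /crossedP[i1 /[dup] c1 /cr[i1i qj e1 e2]].
have [h1 h2 h3] := crossP _ _ _ c1.
apply/crossedP; exists i1; apply/crossP; split=> [|l li|l lj]; rewrite B.
- by rewrite (negPf i1i) e1 !mul0r subr0.
- by rewrite (negPf qj) e2 mulr0 subr0; case: ifP => // _; apply: h2.
- by rewrite (negPf i1i) e1 !mul0r subr0; apply: h3.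
Qed.

Lemma bruhat_crossed g : exists u v, [/\ u \in N, v \in N & crossed ((u * g * v)%g : GL) = setT].
Proof.
have [r] := ubnP #|~: crossed g|; elim: r g => // r IH g /ltnSE ltr.
have [e|/crossed_proper[u [v [un vn lt]]]] := eqVneq (crossed g) setT.
  by exists 1%g, 1%g; rewrite mul1g mulg1 unip1.
have [|u' [v' [un' vn' e]]] := IH (u * g * v)%g.
  by apply: leq_trans (proper_card _) ltr; rewrite properC.
by exists (u' * u)%g, (v * v')%g; rewrite !unipM //; split=> //; rewrite -e !mulgA.
Qed.

End Bruhat.

(** * The antidiagonal involution on biequivariant functions *)

Section AntiInvolution.
Variables (F : finFieldType) (n : nat).
Local Notation GL := {'GL_n.+1[F]}.
Local Notation N := (unip F n.+1).

(** Reflection in the antidiagonal, [g |-> w g^T w]: an anti-involution which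
    preserves [N] together with its superdiagonal. *)
Definition antitr_mx (A : 'M[F]_n.+1) : 'M_n.+1 :=
  \matrix_(i, j) A (rev_ord j) (rev_ord i).

Lemma antitr_mxM A B : antitr_mx (A *m B) = antitr_mx B *m antitr_mx A.
Proof.
apply/matrixP=> i j; rewrite !mxE (reindex_inj rev_ord_inj) /=.
by apply: eq_bigr => l _; rewrite !mxE mulrC.
Qed.

Lemma antitr_mx_unit (g : GL) : antitr_mx g \in unitmx.
Proof.
have e : antitr_mx (invmx g) *m antitr_mx g = 1%:M.
  rewrite -antitr_mxM mulmxV ?GLval_unitmx //; apply/matrixP=> i j.
  by rewrite !mxE (inj_eq rev_ord_inj) eq_sym.
by have [] := mulmx1_unit e.
Qed.

Definition antitr (g : GL) : GL := mkGL (antitr_mx_unit g).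

Lemma antitrE (g : GL) i j :
  (antitr g : 'M_n.+1) i j = (g : 'M_n.+1) (rev_ord j) (rev_ord i).
Proof. by rewrite [LHS]mxE. Qed.

Lemma antitrM (g h : GL) : antitr (g * h)%g = (antitr h * antitr g)%g.
Proof. by apply: GL_eqP; rewrite GL_MxE -antitr_mxM. Qed.

Lemma antitrK : involutive antitr.
Proof. by move=> g; apply: GL_eqP; apply/matrixP => i j; rewrite !antitrE !rev_ordK. Qed.

Lemma antitr_unip (u : GL) : (antitr u \in N) = (u \in N).
Proof.
suff H (v : GL) : v \in N -> antitr v \in N.
  by apply/idP/idP => [/H|/H //]; rewrite antitrK.
move/unipP=> h; apply/unipP => i j ji.
rewrite antitrE h ?(inj_eq rev_ord_inj) 1?eq_sym //= .
by have := ltn_ord i; lia.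
Qed.

Lemma superdiag_sum_antitr (u : GL) : superdiag_sum (antitr u) = superdiag_sum u.
Proof.
rewrite /superdiag_sum (exchange_big_dep predT) //= (reindex_inj rev_ord_inj) /=.
apply: eq_bigr => i _; rewrite (reindex_inj rev_ord_inj) /=.
apply: eq_big => j; last by rewrite antitrE !rev_ordK.
by have := ltn_ord i; have := ltn_ord j; lia.
Qed.

End AntiInvolution.

Section Gelfand.
Variables (R : realType) (F : finFieldType) (psi : F -> R[i]).
Hypotheses (hpsi : is_addchar psi) (hpsi1 : nontrivial_char psi).
Variable n : nat.
Local Notation GL := {'GL_n.+1[F]}.
Local Notation N := (unip F n.+1).
Implicit Types (g u v : GL).

Definition biequivariant (f : GL -> R[i]) := forall u g v, u \in N -> v \in N ->
  f (u * g * v)%g = psi (superdiag_sum u) * f g * psi (superdiag_sum v).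

(** A monomial matrix [g], with permutation [s] and entries [c j], carries the
    root subgroup of [(i, j)] to that of [(s i, s j)], rescaled. If both are
    upper triangular, biequivariance forces [psi] to agree along the two, so
    that a simple root only corresponds to a simple root and with equal
    entries. Hence [s] followed by the reversal has only adjacent unit
    descents, is an involution, and [g] is symmetric in the antidiagonal. *)
Lemma monomial_antitr f g : biequivariant f -> crossed g = setT -> f g != 0 ->
  antitr g = g.
Proof.
move=> hf cg fg.
have [s hs] : exists s : 'I_n.+1 -> 'I_n.+1, forall j, @cross F n g (s j) j.
  have H j : exists i, cross g i j by apply/crossedP; rewrite cg inE.
  by have [s hs] := fin_all_exists H; exists s.
pose c (j : 'I_n.+1) : F := GLval g (s j) j.
have gE i j : GLval g i j = if i == s j then c j else 0.
  by case: eqP => [-> //|/eqP ne]; have [_ h _] := crossP _ _ _ (hs j); rewrite h.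
have c0 j : c j != 0 by have [] := crossP _ _ _ (hs j).
have s_inj : injective s.
  move=> i j e; have [_ _ h] := crossP _ _ _ (hs j).
  by apply/eqP; apply: contraT => /h; rewrite -e => /eqP; rewrite (negPf (c0 i)).
(* [g (1 + x E_ij) = (1 + x' E_(s i, s j)) g] with [x' = x c_i / c_j]. *)
have key (i j : 'I_n.+1) : (i < j)%N -> (s i < s j)%N ->
    (j == i.+1 :> nat)%:R = (s j == (s i).+1 :> nat)%:R * (c i / c j).
  move=> ij sij; apply: (addchar_scale_inj hpsi hpsi1) => x.
  have [u un us] := transvP x ij.
  pose y := c i / c j * x.
  have [v vn vs] := transvP y sij.
  rewrite -us -mulrA -/y -vs.
  have e : (g * transv i j x = transv (s i) (s j) y * g)%g.
    apply: GL_eqP; rewrite !GL_MxE un vn; apply/matrixP=> p q.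
    rewrite mulE_rank1 rank1_mulE; congr (_ + _).
    rewrite -scalemxAr -colE -rowE !mxE !gE eqxx andbT.
    case: (p == s i); rewrite ?mulr0 ?mul0r // (inj_eq s_inj) [j == q]eq_sym.
    case: eqP => [->|_]; rewrite ?mulr0 //=.
    by rewrite /y; field; exact: c0.
  apply: (mulfI fg); rewrite mulrC.
  have := hf 1%g g (transv i j x) (unip1 _ _) u.
  rewrite mul1g e superdiag_sum_unip1 (addchar0 hpsi) mul1r mulrC => <-.
  have := hf (transv (s i) (s j) y) g 1%g v (unip1 _ _).
  by rewrite mulg1 superdiag_sum_unip1 (addchar0 hpsi) mulr1 => ->; rewrite mulrC.
pose t (j : 'I_n.+1) : 'I_n.+1 := rev_ord (s j).
have t_inj : injective t by move=> i j /rev_ord_inj /s_inj.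
have inv : forall i, t (t i) = i /\ c (t i) = c i.
  apply: reversed_involution => //.
  move=> i j ij tij.
  have sij : s j = (s i).+1 :> nat.
    by move: tij; rewrite /=; have := ltn_ord (s i); have := ltn_ord (s j); lia.
  have := key i j ij ltac:(by rewrite sij).
  rewrite sij eqxx mul1r; case: eqP => [ji e|_ /eqP].
    by split=> //; apply: (mulIf (invr_neq0 (c0 j))); rewrite -e divff.
  by rewrite eq_sym mulf_eq0 invr_eq0 !(negPf (c0 _)).
apply: GL_eqP; apply/matrixP => p q; rewrite antitrE !gE.
have tK j : t (t j) = j by have [] := inv j.
have -> : (rev_ord q == s (rev_ord p)) = (q == t (rev_ord p)).
  by rewrite -(inj_eq rev_ord_inj) rev_ordK.
have -> : (p == s q) = (q == t (rev_ord p)).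
  by rewrite -(inj_eq rev_ord_inj) -(inj_eq t_inj) tK eq_sym.
by case: eqP => // ->; have [_ ->] := inv (rev_ord p).
Qed.

(** Double cosets of [N] have monomial representatives, and those that support
    a biequivariant function are fixed by [antitr]. *)
Lemma biequivariant_antitr f g : biequivariant f -> f (antitr g) = f g.
Proof.
move=> hf.
have [u [v [un vn cg]]] := bruhat_crossed g.
set a := (u * g * v)%g in cg.
have hf' : biequivariant (fun g => f (antitr g)).
  move=> u' g' v' un' vn' /=.
  rewrite !antitrM mulgA hf ?antitr_unip // !superdiag_sum_antitr.
  by rewrite mulrAC [RHS]mulrAC [psi _ * _]mulrC -!mulrA [psi _ * f _]mulrC.
have e : f (antitr a) = f a.
  have [fa|fa] := eqVneq (f a) 0; last by rewrite (monomial_antitr hf).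
  have [-> //|fa'] := eqVneq (f (antitr a)) 0.
  by rewrite (monomial_antitr hf').
have := hf' u g v un vn; rewrite /= -/a e (hf u g v un vn).
by move/(mulIf (addchar_neq0 hpsi _))/(mulfI (addchar_neq0 hpsi _)).
Qed.

End Gelfand.

(** * Gelfand's trick *)

Section HeckeCommutativity.
Variables (C : numClosedFieldType) (gT : finGroupType) (G N : {group gT}).
Variables (d : nat) (rho : mx_representation C G d) (chi : gT -> C).
Hypothesis GT : forall g, g \in G.
Hypothesis chi1 : chi 1%g = 1.
Hypothesis chiM : forall u v, u \in N -> v \in N -> chi (u * v)%g = chi u * chi v.
Implicit Types (g h u v : gT) (ell : 'rV[C]_d).

Lemma repM g h : rho (g * h)%g = rho g *m rho h.
Proof. by rewrite repr_mxM ?GT. Qed.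

(** The projection onto the [chi]-equivariant vectors for [N]; its rows span
    the [chi]-equivariant functionals. It is locked because it is a scaled sum,
    inside which the rewriting rules for scaling would otherwise look. *)
Definition char_proj : 'M[C]_d :=
  locked (#|N|%:R^-1 *: \sum_(u in N) chi (u^-1)%g *: rho u).
Local Notation E := char_proj.

Lemma char_projE : E = #|N|%:R^-1 *: \sum_(u in N) chi (u^-1)%g *: rho u.
Proof. by rewrite /char_proj -lock. Qed.

Lemma chiVM u : u \in N -> chi (u^-1)%g * chi u = 1.
Proof. by move=> un; rewrite -chiM ?groupV // mulVg. Qed.

Lemma char_projMr u : u \in N -> E *m rho u = chi u *: E.
Proof.
move=> un; rewrite char_projE -scalemxAl scalerA mulrC -scalerA; congr (_ *: _).
rewrite mulmx_suml scaler_sumr.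
rewrite [LHS](reindex_inj (mulIg u^-1)%g) /=.
apply: eq_big => [v|v]; rewrite groupMr ?groupV // => vn.
by rewrite -scalemxAl -repM mulgKV scalerA invMg invgK chiM ?groupV.
Qed.

Lemma char_projMl u : u \in N -> rho u *m E = chi u *: E.
Proof.
move=> un; rewrite char_projE -scalemxAr scalerA mulrC -scalerA; congr (_ *: _).
rewrite mulmx_sumr scaler_sumr.
rewrite [LHS](reindex_inj (mulgI u^-1)%g) /=.
apply: eq_big => [v|v]; rewrite groupMl ?groupV // => vn.
by rewrite -scalemxAr -repM mulKVg scalerA invMg invgK chiM ?groupV // mulrC.
Qed.

Lemma card_group_neq0 : #|N|%:R != 0 :> C.
Proof. by rewrite pnatr_eq0 -lt0n cardG_gt0. Qed.

Lemma char_proj_col p (v : 'M_(d, p)) :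
  (forall u, u \in N -> rho u *m v = chi u *: v) -> E *m v = v.
Proof.
move=> hv; rewrite char_projE -scalemxAl mulmx_suml (eq_bigr (fun=> v)) => [|u un].
  by rewrite sumr_const -[v *+ _]scaler_nat scalerA mulVf ?scale1r // card_group_neq0.
by rewrite -scalemxAl hv // scalerA chiVM ?scale1r.
Qed.

Lemma char_proj_idem : E *m E = E.
Proof. by apply: char_proj_col => u /char_projMl. Qed.

Lemma char_proj_row ell :
  (forall u, u \in N -> ell *m rho u = chi u *: ell) <-> ell *m E = ell.
Proof.
split=> [hl|h u un]; last by rewrite -h -mulmxA char_projMr // -scalemxAr.
rewrite char_projE -scalemxAr mulmx_sumr (eq_bigr (fun=> ell)) => [|u un].
  by rewrite sumr_const -[ell *+ _]scaler_nat scalerA mulVf ?scale1r // card_group_neq0.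
by rewrite -scalemxAr hl // scalerA chiVM ?scale1r.
Qed.

Variable tau : gT -> gT.
Hypothesis tauM : forall g h, tau (g * h)%g = (tau h * tau g)%g.
Hypothesis tauK : involutive tau.
Hypothesis tau_mem : forall u, (tau u \in N) = (u \in N).
Hypothesis chi_tau : forall u, chi (tau u) = chi u.
Hypothesis tau_biequivariant : forall f : gT -> C,
  (forall u g v, u \in N -> v \in N -> f (u * g * v)%g = chi u * f g * chi v) ->
  forall g, f (tau g) = f g.

(** Every matrix coefficient of [g |-> E rho(g) E] is biequivariant. *)
Lemma char_proj_tau g : E *m rho (tau g) *m E = E *m rho g *m E.
Proof.
apply/matrixP=> i j.
apply: (tau_biequivariant (f := fun g => (E *m rho g *m E) i j)).
move=> u h v un vn; rewrite !repM -!mulmxA char_projMl // !mulmxA.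
rewrite char_projMr // -!scalemxAr -!scalemxAl !mxE; ring.
Qed.

Lemma char_proj_insert g h : (E *m rho g) *m E *m (rho h *m E) =
  #|N|%:R^-1 *: \sum_(u in N) chi (u^-1)%g *: (E *m rho (g * u * h)%g *m E).
Proof.
have key (A B : 'M_d) : A *m E *m B =
    #|N|%:R^-1 *: \sum_(u in N) chi (u^-1)%g *: (A *m rho u *m B).
  rewrite char_projE -scalemxAr -scalemxAl mulmx_sumr mulmx_suml; congr (_ *: _).
  by apply: eq_bigr => u _; rewrite -scalemxAr -scalemxAl.
rewrite key; congr (_ *: _); apply: eq_bigr => u _.
by rewrite !repM !mulmxA.
Qed.

(** Gelfand's trick: an anti-automorphism that fixes the Hecke algebra
    pointwise forces it to be commutative. *)
Lemma hecke_comm g h :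
  (E *m rho g *m E) *m (E *m rho h *m E) = (E *m rho h *m E) *m (E *m rho g *m E).
Proof.
have insert a b : (E *m rho a *m E) *m (E *m rho b *m E) =
  #|N|%:R^-1 *: \sum_(u in N) chi (u^-1)%g *: (E *m rho (a * u * b)%g *m E).
  rewrite -char_proj_insert; move: (rho a) (rho b) char_proj_idem => A B.
  by move: E => e ee; rewrite !mulmxA -(mulmxA _ e e) ee.
rewrite -[in RHS](char_proj_tau g) -[in RHS](char_proj_tau h) !insert.
congr (_ *: _); rewrite [LHS](reindex_inj (can_inj tauK)) /=.
have tau1 : tau 1%g = 1%g.
  by apply: (mulgI (tau 1%g)); rewrite -tauM !mulg1.
have tauV u : tau (u^-1)%g = ((tau u)^-1)%g.
  by apply: (mulgI (tau u)); rewrite -tauM mulVg mulgV.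
apply: eq_big => [u|u un]; first exact: tau_mem.
by rewrite -tauV chi_tau -char_proj_tau !tauM tauK mulgA.
Qed.

Hypothesis rho_irr : mx_irreducible rho.

(** By Burnside's theorem the matrices [rho g] span the full matrix algebra, so
    the whole corner [E M E] is commutative, which bounds the rank of [E]. *)
Lemma corner_comm (A B : 'M[C]_d) :
  (E *m A *m E) *m (E *m B *m E) = (E *m B *m E) *m (E *m A *m E).
Proof.
have [_ [a_ aE]] := mx_abs_irrP (group_closure_closed_field rho_irr).
have lin (M M' : 'M[C]_d) : (E *m M *m E) *m (E *m M' *m E) =
   \sum_(g in G) \sum_(h in G) (a_ g M * a_ h M') *:
     ((E *m rho g *m E) *m (E *m rho h *m E)).
  move: E => e; rewrite {1}[M]aE mulmx_sumr !mulmx_suml; apply: eq_bigr => g _.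
  rewrite {1}[M']aE !(mulmx_sumr, mulmx_suml); apply: eq_bigr => h _.
  by rewrite -!(scalemxAr, scalemxAl) scalerA.
rewrite !lin [RHS]exchange_big /=; apply: eq_bigr => g _; apply: eq_bigr => h _.
by rewrite mulrC hecke_comm.
Qed.

(** The corner elements of the rank one matrices [x *m ell0] and [x *m ell]
    commute; applying [ell0] to both products compares [ell] with [ell0]. *)
Lemma char_functional_unique ell0 ell : ell0 != 0 ->
  ell0 *m E = ell0 -> ell *m E = ell -> exists a, ell = a *: ell0.
Proof.
move=> /rV0Pn[j lj] h0 h1; pose x : 'cV[C]_d := delta_mx j 0.
have key (l l' : 'rV[C]_d) : l *m E = l -> l' *m E = l' ->
   ell0 *m ((E *m (x *m l) *m E) *m (E *m (x *m l') *m E)) =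
   (ell0 *m x) 0 0 * (l *m x) 0 0 *: l'.
  move: E char_proj_idem h0 => e ee h0 hl hl'.
  rewrite !mulmxA -(mulmxA _ e e) ee h0 -(mulmxA _ l e) hl -(mulmxA _ l' e) hl'.
  rewrite -(mulmxA _ l x) [ell0 *m x]mx11_scalar [l *m x]mx11_scalar.
  by rewrite -scalar_mxM mul_scalar_mx !mxE.
have e : (ell0 *m x) 0 0 * (ell0 *m x) 0 0 *: ell = (ell0 *m x) 0 0 * (ell *m x) 0 0 *: ell0.
  by rewrite -(key ell0) // -(key ell) // corner_comm.
have x0 : (ell0 *m x) 0 0 != 0 by rewrite -colE mxE.
exists ((ell *m x) 0 0 / (ell0 *m x) 0 0).
apply: (scalerI (a := (ell0 *m x) 0 0 * (ell0 *m x) 0 0)); first by rewrite mulf_neq0.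
by rewrite e scalerA; congr (_ *: _); field.
Qed.

Lemma char_proj_rank1 ell0 : ell0 != 0 -> ell0 *m E = ell0 ->
  exists v0 : 'cV[C]_d, E = v0 *m ell0.
Proof.
move=> nz w0.
have H i : exists a, row i E = a *: ell0.
  by apply: char_functional_unique => //; rewrite -row_mul char_proj_idem.
have [a ha] := fin_all_exists H; exists (\col_i a i).
apply/row_matrixP=> i; rewrite ha; apply/rowP=> j.
by rewrite !mxE big_ord1 !mxE.
Qed.

End HeckeCommutativity.

(** * Column subgroups of the unipotent group *)

Section ColumnGroups.
Variables (F : finFieldType) (n : nat).
Local Notation GL := {'GL_n.+1[F]}.
Local Notation N := (unip F n.+1).
Implicit Types (y z : 'cV[F]_n.+1) (c i j : 'I_n.+1) (a b : 'rV[F]_n.+1).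

Definition above c y := [forall i : 'I_n.+1, (c <= i)%N ==> (y i 0 == 0)].

Lemma aboveP c y : reflect (forall i, (c <= i)%N -> y i 0 = 0) (above c y).
Proof.
apply: (iffP forallP) => h i; first by move=> ci; have /implyP/(_ ci)/eqP := h i.
by apply/implyP=> ci; rewrite h.
Qed.

Definition colGL c y : GL := rank1 y (delta_mx 0 c).

(** As a functional on columns: the superdiagonal entry of column [c], and zero
    for the first column. *)
Definition prev_row c : 'rV[F]_n.+1 := \row_i (i.+1 == c :> nat)%:R.

Lemma prev_rowE c y : (prev_row c *m y) 0 0 = \sum_(i < n.+1 | i.+1 == c :> nat) y i 0.
Proof.
rewrite mxE (bigID (fun i : 'I_n.+1 => i.+1 == c :> nat)) /= [X in _ + X]big1 => [|i ic].
  by rewrite addr0; apply: eq_bigr => i ic; rewrite mxE ic mul1r.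
by rewrite mxE (negPf ic) mul0r.
Qed.

Lemma colGLP c y : above c y -> [/\ colGL c y \in N,
  GLval (colGL c y) = 1%:M + y *m delta_mx 0 c &
  superdiag_sum (colGL c y) = (prev_row c *m y) 0 0].
Proof.
move=> /aboveP h; have [|v u] := @rank1_unip _ _ y (delta_mx 0 c).
  move=> i j ji; rewrite !mxE eqxx /=; case: eqP => [jc|_]; last by rewrite mulr0.
  by rewrite h ?mul0r // -jc.
rewrite /colGL v; split=> //; rewrite superdiag_sum_rank1 prev_rowE [RHS]big_mkcond /=.
apply: eq_bigr => i _; case: eqP => [ic|ic].
  rewrite (bigD1 c) ?ic //= big1 => [|j /andP[_ nj]].
    by rewrite !mxE !eqxx mulr1 addr0.
  by rewrite !mxE (negPf nj) andbF mulr0.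
rewrite big1 // => j /eqP ji; rewrite !mxE.
by case: (j =P c) => [jc|_]; rewrite ?mulr0 //; case: ic; rewrite -jc.
Qed.

Lemma above0 c : above c 0.
Proof. by apply/aboveP => i _; rewrite mxE. Qed.

Lemma aboveD c y z : above c y -> above c z -> above c (y + z).
Proof. by move=> /aboveP hy /aboveP hz; apply/aboveP => i ci; rewrite mxE hy ?hz ?addr0. Qed.

Lemma aboveN c y : above c (- y) = above c y.
Proof. by apply: eq_forallb => i; rewrite mxE oppr_eq0. Qed.

Lemma aboveZ c x y : above c y -> above c (x *: y).
Proof. by move=> /aboveP hy; apply/aboveP => i ci; rewrite mxE hy ?mulr0. Qed.

Lemma aboveW c j y : (c <= j)%N -> above c y -> above j y.
Proof. by move=> cj /aboveP h; apply/aboveP => i ji; apply/h/(leq_trans cj). Qed.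

Lemma colGL0 c : colGL c 0 = 1%g.
Proof. by apply: GL_eqP; have [_ -> _] := colGLP (above0 c); rewrite mul0mx addr0. Qed.

Lemma delta_above c y j : above c y -> (c <= j)%N -> (delta_mx 0 j : 'rV_n.+1) *m y = 0.
Proof. by move=> /aboveP hy cj; rewrite -rowE; apply/rowP=> i; rewrite !ord1 !mxE hy. Qed.

Lemma colGLM c y z : above c y -> above c z ->
  (colGL c y * colGL c z)%g = colGL c (y + z).
Proof.
move=> hy hz; apply: GL_eqP; rewrite GL_MxE.
have [_ -> _] := colGLP hy; have [_ -> _] := colGLP hz.
have [_ -> _] := colGLP (aboveD hy hz).
rewrite mulmxDl mul1mx mulmxDr mulmx1 -mulmxA (mulmxA (delta_mx _ _)).
rewrite (delta_above hz) // mul0mx mulmx0 addr0 mulmxDl.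
by rewrite -addrA; congr (_ + _); rewrite addrC.
Qed.

(** Such matrices normalise the group of the [colGL c y], hence permute its
    characters. *)
Definition lower_id c (h : GL) := forall i j, (c <= i)%N -> GLval h i j = (i == j)%:R.

Lemma lower_id_above c h y : lower_id c h -> above c y -> above c (GLval h *m y).
Proof.
move=> hh /aboveP hy; apply/aboveP => i ci; rewrite mxE (bigD1 i) //= hy // mulr0.
by rewrite add0r big1 // => j nj; rewrite hh // eq_sym (negPf nj) mul0r.
Qed.

Lemma lower_id_colGL c h y : lower_id c h -> above c y ->
  (h * colGL c y)%g = (colGL c (GLval h *m y) * h)%g.
Proof.
move=> hh hy; apply: GL_eqP; rewrite !GL_MxE.
have [_ -> _] := colGLP hy; have [_ -> _] := colGLP (lower_id_above hh hy).
rewrite mulmxDr mulmx1 mulmxDl mul1mx -!mulmxA; congr (_ + _ *m (_ *m _)).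
by rewrite -rowE; apply/rowP => j; rewrite !mxE hh // eqxx eq_sym.
Qed.

Lemma lower_id_inv c h : lower_id c h -> lower_id c (h^-1)%g.
Proof.
move=> hh i j ci.
have : row i (GLval h *m invmx h) = row i 1%:M by rewrite mulmxV ?GLval_unitmx.
rewrite row_mul; have -> : row i h = delta_mx 0 i.
  by apply/rowP => l; rewrite !mxE hh // eqxx eq_sym.
by rewrite -rowE => /rowP/(_ j); rewrite !mxE.
Qed.

Lemma colGL_comm c j y z : (c < j)%N -> above c y -> above j z ->
  (colGL j z * colGL c y)%g = (colGL c y * colGL j (z - z c 0 *: y))%g.
Proof.
move=> cj hy hz; have hy' := aboveW (ltnW cj) hy.
have hz' : above j (z - z c 0 *: y) by rewrite aboveD // aboveN aboveZ.
apply: GL_eqP; rewrite !GL_MxE.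
have [_ -> _] := colGLP hy; have [_ -> _] := colGLP hz; have [_ -> _] := colGLP hz'.
have cw : delta_mx 0 c *m (z - z c 0 *: y) = (z c 0)%:M.
  rewrite -rowE; apply/rowP=> l; rewrite !ord1 !mxE eqxx mulr1n.
  by move/aboveP: hy => ->; rewrite // mulr0 subr0.
have [w wE] : exists w, w = z - z c 0 *: y by eexists.
rewrite -wE in cw *.
rewrite !mulmxDl !mulmxDr !mul1mx !mulmx1 -!mulmxA !(mulmxA (delta_mx _ _) _ (delta_mx _ _)).
rewrite (delta_above hy (ltnW cj)) cw mul0mx mulmx0 addr0 wE.
rewrite mul_scalar_mx -scalemxAr mulmxBl -scalemxAl -!addrA; congr (_ + _).
by rewrite [X in _ = _ + X]addrCA addNr addr0 addrC.
Qed.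

Definition colpart j (u : GL) : 'cV[F]_n.+1 := \col_i (if (i < j)%N then GLval u i j else 0).

Lemma above_colpart j u : above j (colpart j u).
Proof. by apply/aboveP => i ji; rewrite mxE ltnNge ji. Qed.

End ColumnGroups.

(** * Fourier analysis along a column *)

Section ColumnProj.
Variables (R : realType) (F : finFieldType) (psi : F -> R[i]).
Hypotheses (hpsi : is_addchar psi) (hpsi1 : nontrivial_char psi).
Variables (n d : nat) (rho : mx_representation R[i] 'GL_n.+1[F] d).
Local Notation GL := {'GL_n.+1[F]}.
Local Notation N := (unip F n.+1).
Implicit Types (y z : 'cV[F]_n.+1) (c i j : 'I_n.+1) (a b : 'rV[F]_n.+1).
Implicit Type v : 'cV[R[i]]_d.

Definition whittaker_char (u : GL) := psi (superdiag_sum u).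

Definition whittaker_proj : 'M[R[i]]_d := char_proj (unip_group F n) rho whittaker_char.
Local Notation E := whittaker_proj.

Lemma repGLM (g h : GL) : rho (g * h)%g = rho g *m rho h.
Proof. exact: (repM rho (@mem_GL F n)). Qed.

Lemma repGL1 : rho (1%g : GL) = 1%:M.
Proof. exact: repr_mx1. Qed.

Lemma whittaker_char1 : whittaker_char 1%g = 1.
Proof. by rewrite /whittaker_char superdiag_sum_unip1 (addchar0 hpsi). Qed.

Lemma whittaker_charM (u v : GL) : u \in N -> v \in N ->
  whittaker_char (u * v)%g = whittaker_char u * whittaker_char v.
Proof. by move=> un vn; rewrite /whittaker_char superdiag_sum_unipM // (addcharD hpsi). Qed.

(** A unipotent matrix is the product of its columns, taken from right to
    left. *)
Lemma rho_unip_col (u : GL) v (b : 'I_n.+1 -> F) : u \in N ->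
  (forall j, rho (colGL j (colpart j u)) *m v = psi (b j) *: v) ->
  rho u *m v = psi (\sum_j b j) *: v.
Proof.
move=> /unipP un hv.
suff [w [we wv]] : exists w : GL, GLval w = GLval u /\
    rho w *m v = psi (\sum_j b j) *: v.
  by rewrite -(GL_eqP we).
have H (r : nat) : (r <= n.+1)%N -> exists w : GL,
    GLval w = \matrix_(i, j) (if (j < r)%N then GLval u i j else (i == j)%:R) /\
    rho w *m v = psi (\sum_(j < n.+1 | (j < r)%N) b j) *: v.
  elim: r => [_|r IH lt].
    exists 1%g; rewrite repGL1 mul1mx big1 // (addchar0 hpsi) scale1r; split=> //.
    by apply/matrixP=> i j; rewrite !mxE.
  have [w [we wv]] := IH (ltnW lt).
  pose c := Ordinal lt.
  exists (colGL c (colpart c u) * w)%g; split; last first.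
    rewrite repGLM -mulmxA wv -scalemxAr hv scalerA -(addcharD hpsi).
    congr (psi _ *: _); rewrite [RHS](bigD1 c) //= addrC; congr (_ + _).
    apply: eq_bigl => j; rewrite ltnS -(inj_eq val_inj) /=.
    by rewrite [(j < r)%N]ltn_neqAle andbC.
  rewrite GL_MxE; have [_ -> _] := colGLP (above_colpart c u).
  rewrite we; apply/matrixP => i j; rewrite rank1_mulE -rowE !mxE /= ltnS.
  have [jr|jr|jr] := ltngtP j r.
  - by rewrite (un c) /= ?(ltnW jr) // -val_eqE /= gtn_eqF // mulr0 addr0.
  - by rewrite -[c == j]val_eqE /= ltn_eqF // mulr0 addr0.
  - have -> : j = c by apply: val_inj.
    rewrite eqxx mulr1; case: ltnP => ic.
      by rewrite -val_eqE /= ltn_eqF // add0r.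
    by rewrite addr0 un.
have [w [we wv]] := H n.+1 (leqnn _).
exists w; rewrite we wv; split.
  by apply/matrixP => i j; rewrite !mxE ltn_ord.
by congr (psi _ *: _); apply: eq_bigl => j; rewrite ltn_ord.
Qed.

(** Up to a scalar, the projection onto the vectors on which the group of the
    [colGL c y] acts through the character [y |-> psi (a y)]. *)
Definition col_proj c a : 'M[R[i]]_d :=
  \sum_(y | above c y) psi (- (a *m y) 0 0) *: rho (colGL c y).

(** Fourier inversion at the identity. The sum runs over all rows [a], so each
    character of the column group is counted several times. *)
Lemma col_proj_sum c : \sum_a col_proj c a = (#|F|%:R ^+ n.+1) *: 1%:M.
Proof.
rewrite exchange_big (bigD1 0) ?above0 //= [X in _ + X]big1 => [|y /andP[_ ny]].
  rewrite colGL0 repGL1 addr0 -scaler_suml.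
  under eq_bigr do rewrite mulmx0 mxE oppr0 (addchar0 hpsi).
  by rewrite sumr_const card_mx mul1n natrX.
rewrite -scaler_suml.
have -> : \sum_(a : 'rV_n.+1) psi (- (a *m y) 0 0) =
          \sum_(a : 'rV_n.+1) psi ((a *m (- y)) 0 0).
  by apply: eq_bigr => a _; rewrite mulmxN [in RHS]mxE.
by rewrite (sum_addchar_row hpsi hpsi1) oppr_eq0 (negPf ny) mul0r scale0r.
Qed.

Lemma col_proj_eq c a b : (forall i, (i < c)%N -> a 0 i = b 0 i) ->
  col_proj c a = col_proj c b.
Proof.
move=> ab; apply: eq_bigr => y /aboveP hy; congr (psi (- _) *: _).
rewrite !mxE; apply: eq_bigr => i _.
by have [ci|/ab ->//] := leqP c i; rewrite hy // !mulr0.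
Qed.

Lemma col_projMr c a z : above c z ->
  col_proj c a *m rho (colGL c z) = psi ((a *m z) 0 0) *: col_proj c a.
Proof.
move=> hz; rewrite mulmx_suml [LHS](reindex_inj (addIr (- z))) scaler_sumr.
apply: eq_big => [y|y hy].
  apply/idP/idP => [h|h]; last by rewrite aboveD ?aboveN.
  by rewrite -(subrK z y) aboveD.
rewrite -scalemxAl -repGLM colGLM // subrK scalerA -(addcharD hpsi).
by congr (psi _ *: _); rewrite mulmxBr !mxE opprD opprK addrC.
Qed.

Lemma col_projMl c a z : above c z ->
  rho (colGL c z) *m col_proj c a = psi ((a *m z) 0 0) *: col_proj c a.
Proof.
move=> hz; rewrite -col_projMr // mulmx_suml mulmx_sumr; apply: eq_bigr => y hy.
by rewrite -scalemxAr -scalemxAl -!repGLM (colGLM hz hy) (colGLM hy hz) addrC.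
Qed.

Lemma col_proj_lower_id c a (h : GL) : lower_id c h ->
  rho h *m col_proj c (a *m GLval h) = col_proj c a *m rho h.
Proof.
move=> hh; rewrite mulmx_sumr mulmx_suml.
rewrite [RHS](reindex_inj (can_inj (mulKmx (GLval_unitmx h)))).
apply: eq_big => [y|y hy].
  apply/idP/idP => [/(lower_id_above hh)//|].
  by move/(lower_id_above (lower_id_inv hh)); rewrite mulKmx ?GLval_unitmx.
by rewrite -scalemxAr -scalemxAl -!repGLM lower_id_colGL // mulmxA.
Qed.

Lemma col_proj_move c a (h : GL) v x : lower_id c h -> x != 0 -> rho h *m v = x *: v ->
  col_proj c (a *m GLval h) *m v = 0 -> col_proj c a *m v = 0.
Proof.
move=> hh nx hv e.
have : col_proj c a *m (rho h *m v) = 0.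
  by rewrite mulmxA -col_proj_lower_id // -mulmxA e mulmx0.
by rewrite hv -scalemxAr => /eqP; rewrite scaler_eq0 (negPf nx) => /eqP.
Qed.

Lemma col_proj_stab c a (h : GL) v x : lower_id c h -> rho h *m v = x *: v ->
  (forall i, (i < c)%N -> (a *m GLval h) 0 i = a 0 i) ->
  rho h *m (col_proj c a *m v) = x *: (col_proj c a *m v).
Proof.
move=> hh hv /col_proj_eq e; rewrite mulmxA -{1}e col_proj_lower_id //.
by rewrite -mulmxA hv -scalemxAr.
Qed.

Lemma col_proj_neq c a v z x : above c z -> rho (colGL c z) *m v = x *: v ->
  x != psi ((a *m z) 0 0) -> col_proj c a *m v = 0.
Proof.
move=> hz hv nx; have : col_proj c a *m (rho (colGL c z) *m v) = x *: (col_proj c a *m v).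
  by rewrite hv scalemxAr.
rewrite mulmxA col_projMr // -scalemxAl => /eqP; rewrite -subr_eq0 -scalerBl.
by rewrite scaler_eq0 subr_eq0 eq_sym (negPf nx) => /eqP.
Qed.

Definition col_equiv j v := forall z, above j z ->
  rho (colGL j z) *m v = psi ((prev_row F j *m z) 0 0) *: v.

(** The commutator of [colGL c y] and [colGL j z] lies in the group of column
    [j], and its superdiagonal entry vanishes since [y] lives above [c < j]. *)
Lemma col_equiv_proj c j a v : (c < j)%N -> col_equiv j v ->
  col_equiv j (col_proj c a *m v).
Proof.
move=> cj hv z hz; rewrite !mulmx_suml mulmx_sumr scaler_sumr; apply: eq_bigr => y hy.
have hy' := aboveW (ltnW cj) hy.
have hz' : above j (z - z c 0 *: y) by rewrite aboveD // aboveN aboveZ.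
rewrite -!scalemxAl -scalemxAr mulmxA -repGLM (colGL_comm cj hy hz) repGLM -mulmxA (hv _ hz').
rewrite -scalemxAr !scalerA mulrC mulmxBr -scalemxAr.
have -> : prev_row F j *m y = 0.
  apply/rowP=> l; rewrite !ord1 prev_rowE mxE big1 // => i /eqP ij.
  by move/aboveP: hy; apply; rewrite -ltnS ij.
by rewrite scaler0 subr0.
Qed.

Lemma col_equiv_self c v : col_equiv c (col_proj c (prev_row F c) *m v).
Proof. by move=> z hz; rewrite mulmxA col_projMl // scalemxAl. Qed.

Lemma whittaker_col_proj c v : E *m v = 0 -> E *m (col_proj c (prev_row F c) *m v) = 0.
Proof.
move=> Ev; rewrite mulmxA mulmx_sumr mulmx_suml big1 // => y hy.
have [yN _ ys] := colGLP hy.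
rewrite -scalemxAr (char_projMr rho (@mem_GL F n) whittaker_charM yN).
by rewrite -!scalemxAl Ev !scaler0.
Qed.

Lemma col_equiv_whittaker v : (forall j, col_equiv j v) -> E *m v = v.
Proof.
move=> hv; apply: (char_proj_col whittaker_char1 whittaker_charM) => u un.
rewrite (rho_unip_col (b := fun j => (prev_row F j *m colpart j u) 0 0)) //.
  congr (psi _ *: _); rewrite /superdiag_sum (exchange_big_dep predT) //=.
  apply: eq_bigr => j _; rewrite prev_rowE; apply: eq_big => [i|i /eqP ij].
    by rewrite eq_sym.
  by rewrite mxE -ij ltnSn.
by move=> j; rewrite hv // above_colpart.
Qed.

(** A vector fixed by the [c]-th column group and equivariant under the later
    ones is fixed by a whole unipotent radical. *)
Lemma cuspidal_col_proj c v : cuspidal rho -> (0 < c)%N ->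
  (forall j, (c < j)%N -> col_equiv j v) -> col_proj c 0 *m v = 0.
Proof.
move=> hc c0 hv; apply: (hc c); first by rewrite c0 /=.
move=> u ur.
have ue (i j : 'I_n.+1) : ~~ ((i < c) && (c <= j))%N -> GLval u i j = (i == j)%:R.
  move=> ij; move: ur; rewrite inE => /forallP/(_ i)/forallP/(_ j)/implyP/(_ ij).
  by move/eqP.
have un : u \in N.
  apply/unipP => i j ji; apply: ue; apply/negP => /andP[ic cj].
  by move: (leq_trans ic (leq_trans cj ji)); rewrite ltnn.
rewrite (rho_unip_col (b := fun=> 0)) //.
  by rewrite big1 // (addchar0 hpsi) scale1r.
move=> j; rewrite (addchar0 hpsi) scale1r.
have up i : (c <= i)%N || (j < c)%N -> colpart j u i 0 = 0.
  move=> h; rewrite mxE; case: ltnP => // ij; rewrite ue.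
    by rewrite -val_eqE /= ltn_eqF.
  by rewrite negb_and -leqNgt -ltnNge.
have [jc|cj|/val_inj jc] := ltngtP j c.
- have -> : colpart j u = 0 by apply/colP=> i; rewrite up ?jc ?orbT // mxE.
  by rewrite colGL0 repGL1 mul1mx.
- rewrite (col_equiv_proj _ cj) ?above_colpart //; last exact: hv.
  rewrite prev_rowE big1 ?(addchar0 hpsi) ?scale1r // => i /eqP ij.
  by apply: up; rewrite -ltnS ij cj.
- rewrite jc mulmxA col_projMl ?above_colpart // mul0mx mxE (addchar0 hpsi).
  by rewrite scale1r.
Qed.

End ColumnProj.

(** * The Shalika subgroup in interleaved coordinates *)

Section ShalikaElements.
Variables (F : finFieldType) (k : nat).
Local Notation m := k.+1.
Local Notation GL := {'GL_(m + m)[F]}.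
Local Notation sg := (sigmaGL F k).
Implicit Types (X : 'M[F]_m) (p : {'GL_m[F]}) (i j : 'I_m).

(** A rank one perturbation [1 + x y] of the identity suffices: [y] is forced to
    be a multiple of the difference of the two rows, and the determinant is a
    multiple of [x t 0]. The two clauses on entries keep the element inside a
    smaller linear group when [al] and [t] belong to it. *)
Lemma GL_move_row (al : 'rV[F]_m) i0 t : al 0 i0 != 0 ->
  exists g : {'GL_m[F]}, [/\ al *m GLval g = delta_mx 0 t,
    forall i j, i != t -> i != i0 -> GLval g i j = (i == j)%:R &
    forall i j, al 0 j = 0 -> j != t -> GLval g i j = (i == j)%:R].
Proof.
move=> ai0.
pose x : 'cV[F]_m := delta_mx t 0 + (if al 0 t == 0 then delta_mx i0 0 else 0).
have xt : x t 0 = 1.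
  rewrite !mxE !eqxx; case: ifP => [/eqP e|_]; rewrite mxE ?addr0 //.
  case: (t =P i0) => [ti|_]; last by rewrite addr0.
  by move: ai0; rewrite -ti e eqxx.
have x0 i : i != t -> i != i0 -> x i 0 = 0.
  move=> it ii; rewrite !mxE (negPf it) add0r.
  by case: ifP => _; rewrite mxE ?(negPf ii).
have b0 : (al *m x) 0 0 != 0.
  rewrite /x mulmxDr -colE; case: ifP => [/eqP at0|/negbT at0].
    by rewrite -colE !mxE at0 add0r.
  by rewrite mulmx0 !mxE addr0.
move: x xt x0 b0 => x xt x0; set b := (al *m x) 0 0 => b0.
pose y : 'rV[F]_m := b^-1 *: (delta_mx 0 t - al).
have yx : 1 + (y *m x) 0 0 = b^-1.
  rewrite -scalemxAl mulmxBl -rowE [al *m x]mx11_scalar -/b !mxE xt eqxx mulr1n.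
  by field.
exists (GLof (1%:M + x *m y)).
rewrite val_GLof; last by rewrite rank1_unit // yx invr_eq0.
split.
- rewrite mulmxDr mulmx1 mulmxA [al *m x]mx11_scalar -/b mul_scalar_mx.
  by rewrite scalerA divff // scale1r addrC subrK.
- by move=> i j it ii; rewrite !mxE big_ord1 x0 // mul0r addr0.
- move=> i j aj jt; rewrite !mxE big_ord1 !mxE aj (negPf jt) andbF subr0.
  by rewrite !mulr0 addr0.
Qed.

(** Conjugation by [sg] interleaves the two halves of the basis, the indices
    [i] and [m + i] becoming [2i] and [2i + 1]. After it, the unipotent radical
    has its entries at even rows and odd columns, and the Levi subgroup acts in
    the same way on the even and on the odd indices. *)
Definition uGL X : GL := (sg * shearGL X * sg^-1)%g.
Definition dGL p : GL := (sg * doubleGL p * sg^-1)%g.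

Definition ev i : 'I_(m + m) := sigma_ord (lshift m i).
Definition od i : 'I_(m + m) := sigma_ord (rshift m i).

Lemma val_ev i : ev i = i.*2 :> nat.
Proof. by rewrite /ev /= /sigma_fun /= ltn_ord. Qed.

Lemma val_od i : od i = i.*2.+1 :> nat.
Proof. by rewrite /od /= /sigma_fun /= ltnNge leq_addr /= addKn. Qed.

Lemma sum_evod (V : nmodType) (f : 'I_(m + m) -> V) :
  \sum_l f l = \sum_i f (ev i) + \sum_i f (od i).
Proof. by rewrite (reindex_inj (@sigma_ord_inj k)) big_split_ord. Qed.

Lemma evodP (P : 'I_(m + m) -> Prop) :
  (forall i, P (ev i)) -> (forall i, P (od i)) -> forall l, P l.
Proof.
move=> he ho l; have [s sK Ks] := injF_bij (@sigma_ord_inj k).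
by rewrite -(Ks l) -(splitK (s l)); case: (split (s l)) => i; [exact: he|exact: ho].
Qed.

Lemma ev_inj : injective ev.
Proof. by move=> i j /sigma_ord_inj/lshift_inj. Qed.

Lemma od_inj : injective od.
Proof. by move=> i j /sigma_ord_inj/rshift_inj. Qed.

Lemma ev_od i j : (ev i == od j) = false.
Proof. by rewrite (inj_eq (@sigma_ord_inj k)) eq_lrshift. Qed.

Lemma od_ev i j : (od i == ev j) = false.
Proof. by rewrite eq_sym ev_od. Qed.

Lemma sigma_conjE (g : GL) a b :
  GLval (sg * g * sg^-1)%g (sigma_ord a) (sigma_ord b) = GLval g a b.
Proof.
pose s := perm (@sigma_ord_inj k).
have sgE : GLval sg = perm_mx s^-1 by rewrite -tr_perm_mx.
have sgVE : GLval (sg^-1)%g = perm_mx s.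
  apply: (can_inj (mulKmx (GLval_unitmx sg))).
  by rewrite GL_VxE mulmxV ?GLval_unitmx // sgE -perm_mxM mulVg perm_mx1.
have sV (i : 'I_(m + m)) : (s^-1)%g (sigma_ord i) = i.
  by rewrite -[sigma_ord i](permE (@sigma_ord_inj k)) permK.
by rewrite !GL_MxE sgE sgVE -row_permE -[s in X in _ *m X]invgK -col_permE !mxE !sV.
Qed.

Lemma uGLE X : [/\ forall i j, GLval (uGL X) (ev i) (ev j) = (i == j)%:R,
  forall i j, GLval (uGL X) (ev i) (od j) = X i j,
  forall i j, GLval (uGL X) (od i) (ev j) = 0 &
  forall i j, GLval (uGL X) (od i) (od j) = (i == j)%:R].
Proof.
have e a b : GLval (uGL X) (sigma_ord a) (sigma_ord b) = (block_mx 1%:M X 0 1%:M) a b.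
  exact: sigma_conjE.
by split=> i j; rewrite [LHS]e (block_mxEul, block_mxEur, block_mxEdl, block_mxEdr) ?mxE.
Qed.

Lemma dGLE p : [/\ forall i j, GLval (dGL p) (ev i) (ev j) = GLval p i j,
  forall i j, GLval (dGL p) (ev i) (od j) = 0,
  forall i j, GLval (dGL p) (od i) (ev j) = 0 &
  forall i j, GLval (dGL p) (od i) (od j) = GLval p i j].
Proof.
have e a b : GLval (dGL p) (sigma_ord a) (sigma_ord b) = (block_mx (GLval p) 0 0 (GLval p)) a b.
  exact: sigma_conjE.
by split=> i j; rewrite [LHS]e (block_mxEul, block_mxEur, block_mxEdl, block_mxEdr) ?mxE.
Qed.

Lemma mul_uGL (a : 'rV[F]_(m + m)) X :
  (forall j, (a *m GLval (uGL X)) 0 (ev j) = a 0 (ev j)) /\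
  (forall j, (a *m GLval (uGL X)) 0 (od j) = a 0 (od j) + \sum_i a 0 (ev i) * X i j).
Proof.
have [ee eo oe oo] := uGLE X; split=> j; rewrite mxE sum_evod.
  rewrite [X in _ + X]big1 ?addr0 => [|i _]; last by rewrite oe mulr0.
  rewrite (bigD1 j) //= ee eqxx mulr1 big1 ?addr0 // => i ij.
  by rewrite ee (negPf ij) mulr0.
rewrite addrC; congr (_ + _); last by apply: eq_bigr => i _; rewrite eo.
rewrite (bigD1 j) //= oo eqxx mulr1 big1 ?addr0 // => i ij.
by rewrite oo (negPf ij) mulr0.
Qed.

Lemma mul_dGL (a : 'rV[F]_(m + m)) p :
  (forall j, (a *m GLval (dGL p)) 0 (ev j) = \sum_i a 0 (ev i) * GLval p i j) /\
  (forall j, (a *m GLval (dGL p)) 0 (od j) = \sum_i a 0 (od i) * GLval p i j).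
Proof.
have [ee eo oe oo] := dGLE p; split=> j; rewrite mxE sum_evod.
  rewrite [X in _ + X]big1 ?addr0 => [|i _]; last by rewrite oe mulr0.
  by apply: eq_bigr => i _; rewrite ee.
rewrite [X in X + _]big1 ?add0r => [|i _]; last by rewrite eo mulr0.
by apply: eq_bigr => i _; rewrite oo.
Qed.

Lemma lower_id_uGL (c : 'I_(m + m)) X : (forall i j, (c <= i.*2)%N -> X i j = 0) ->
  @lower_id F (k + k.+1) c (uGL X).
Proof.
have [ee eo oe oo] := uGLE X => hX.
elim/evodP => i; elim/evodP => j; rewrite ?ee ?eo ?oe ?oo ?(inj_eq ev_inj) //.
- by rewrite ev_od => ci; rewrite hX // -val_ev.
- by rewrite od_ev.
- by rewrite (inj_eq od_inj).
Qed.

Lemma lower_id_dGL (c : 'I_(m + m)) p : (forall i j, (c <= i.*2.+1)%N -> GLval p i j = (i == j)%:R) ->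
  @lower_id F (k + k.+1) c (dGL p).
Proof.
have [ee eo oe oo] := dGLE p => hp.
elim/evodP => i; elim/evodP => j; rewrite ?ee ?eo ?oe ?oo ?(inj_eq ev_inj).
- by rewrite val_ev => ci; rewrite hp // ltnW.
- by rewrite ev_od.
- by rewrite od_ev.
- by rewrite (inj_eq od_inj) => ci; rewrite hp // -val_od.
Qed.

Local Notation prev_row := (@prev_row F (k + k.+1)).

Lemma prev_od t : (forall i, prev_row (od t) 0 (ev i) = (i == t)%:R) /\
  (forall i, prev_row (od t) 0 (od i) = 0).
Proof.
split=> i; rewrite mxE val_od ?val_ev ?val_od eqSS.
  by rewrite (inj_eq double_inj).
by case: eqP => // /(congr1 odd); rewrite /= !odd_double.
Qed.

Lemma prev_ev t : (forall i, prev_row (ev t) 0 (ev i) = 0) /\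
  (forall i, prev_row (ev t) 0 (od i) = (i.+1 == t :> nat)%:R).
Proof.
split=> i; rewrite mxE val_ev ?val_ev ?val_od.
  by case: eqP => // /(congr1 odd); rewrite /= !odd_double.
by rewrite -doubleS (inj_eq double_inj).
Qed.

End ShalikaElements.

(** * Whittaker projections of Shalika vectors *)

Section ShalikaVectors.
Variables (R : realType) (F : finFieldType) (psi : F -> R[i]).
Hypotheses (hpsi : is_addchar psi) (hpsi1 : nontrivial_char psi).
Variables (k d : nat).
Local Notation m := k.+1.
Local Notation n := (k + k.+1)%N.
Variable rho : mx_representation R[i] 'GL_(k.+1 + k.+1)[F] d.
Hypothesis rho_cusp : cuspidal rho.
Local Notation GL := {'GL_(m + m)[F]}.
Local Notation sg := (sigmaGL F k).
Implicit Types (X : 'M[F]_m) (p : {'GL_m[F]}) (i j t : 'I_m) (v : 'cV[R[i]]_d).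
Local Notation col_proj := (@col_proj R F psi n d rho).
Local Notation col_equiv := (@col_equiv R F psi n d rho).
Local Notation prev_row := (@prev_row F n).
Local Notation E := (@whittaker_proj R F psi n d rho).
Local Notation above := (@above F n).
Local Notation colGL := (@colGL F n).

Lemma col_proj_all0 (c : 'I_(m + m)) v : (forall a, col_proj c a *m v = 0) -> v = 0.
Proof.
move=> h; have : (\sum_a col_proj c a) *m v = 0.
  by rewrite mulmx_suml big1.
rewrite (col_proj_sum hpsi hpsi1) -scalemxAl mul1mx => /eqP.
rewrite scaler_eq0 expf_eq0 /= pnatr_eq0 => /orP[|/eqP //].
by rewrite -leqn0 leqNgt (cardD1 0).
Qed.

(** The vector is Whittaker-equivariant in the columns from [2s] on, and before
    them it is a Shalika vector for the mirabolic of [GL_s]. *)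
Definition shalika_stage (s : nat) v := [/\
  forall X, (forall i j, (s <= i)%N || (s <= j)%N -> X i j = 0) ->
    rho (uGL X) *m v = psi (\tr X) *: v,
  forall p, (forall i j, (s <= i.+1)%N || (s <= j)%N -> GLval p i j = (i == j)%:R) ->
    rho (dGL p) *m v = v &
  forall j : 'I_(m + m), (s.*2 <= j)%N -> col_equiv j v].

(** The same, when column [2s + 1] is done but column [2s] is not: the last
    column of the mirabolic of [GL_(s + 1)] is still available. *)
Definition shalika_half_stage (s : nat) v := [/\
  forall X, (forall i j, (s <= i)%N || (s <= j)%N -> X i j = 0) ->
    rho (uGL X) *m v = psi (\tr X) *: v,
  forall p, (forall i j, (s <= i)%N || (s < j)%N -> GLval p i j = (i == j)%:R) ->
    rho (dGL p) *m v = v &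
  forall j : 'I_(m + m), (s.*2 < j)%N -> col_equiv j v].

Lemma colGL_uGL i t x : (i <= t)%N ->
  above (od t) (x *: delta_mx (ev i) 0) /\
  uGL (x *: delta_mx i t) = colGL (od t) (x *: delta_mx (ev i) 0).
Proof.
move=> it; have ab : above (od t) (x *: delta_mx (ev i) 0).
  apply/aboveP => l tl; rewrite !mxE andbT; case: eqP => [li|]; rewrite ?mulr0 //.
  by move: tl; rewrite li val_od val_ev ltn_double ltnNge it.
split=> //; apply: GL_eqP; have [_ -> _] := colGLP ab.
have [ee eo oe oo] := uGLE (x *: delta_mx i t : 'M[F]_m).
apply/matrixP; elim/evodP => i'; elim/evodP => j';
  rewrite ?ee ?eo ?oe ?oo !mxE big_ord1 !mxE eqxx ?andbT /=
    ?ev_od ?od_ev ?(inj_eq (@ev_inj k)) ?(inj_eq (@od_inj k)) ?mulr0 ?mul0r ?addr0 ?add0r //.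
by rewrite -mulrA -natrM mulnb.
Qed.

Lemma colGL_dGL i t x : (i < t)%N -> [/\ above (ev t) (x *: delta_mx (ev i) 0),
  above (od t) (x *: delta_mx (od i) 0) &
  dGL (transv i t x) =
   (colGL (ev t) (x *: delta_mx (ev i) 0) * colGL (od t) (x *: delta_mx (od i) 0))%g].
Proof.
move=> it; have ab1 : above (ev t) (x *: delta_mx (ev i) 0).
  apply/aboveP => l tl; rewrite !mxE andbT; case: eqP => [li|]; rewrite ?mulr0 //.
  by move: tl; rewrite li !val_ev leq_double leqNgt it.
have ab2 : above (od t) (x *: delta_mx (od i) 0).
  apply/aboveP => l tl; rewrite !mxE andbT; case: eqP => [li|]; rewrite ?mulr0 //.
  by move: tl; rewrite li !val_od ltnS leq_double leqNgt it.
split=> //; apply: GL_eqP; rewrite [RHS]GL_MxE.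
have [_ -> _] := colGLP ab1; have [_ -> _] := colGLP ab2.
have [ee eo oe oo] := dGLE (transv i t x).
have [_ tE _] := transvP x it.
apply/matrixP; elim/evodP => i'; elim/evodP => j';
  rewrite ?ee ?eo ?oe ?oo ?tE rank1_mulE -rowE !mxE !big_ord1 !mxE ?eqxx ?andbT ?andTb /=
    ?ev_od ?od_ev ?(inj_eq (@ev_inj k)) ?(inj_eq (@od_inj k)) ?mulr0 ?mul0r ?addr0 ?add0r //=.
- by rewrite [t == _]eq_sym.
- by rewrite mulr0.
Qed.

(** First half of the induction: the column [2t + 1]. Equivariance under the
    entries [(2i, 2t + 1)] of [uGL X] leaves undetermined only the odd
    coordinates of a character occurring in [v], and the entries [(2t, 2j + 1)]
    translate these to zero. *)
Lemma stage_half t v : shalika_stage t.+1 v ->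
  let v1 := col_proj (od t) (prev_row (od t)) *m v in
  (v1 = 0 -> v = 0) /\ shalika_half_stage t v1.
Proof.
move=> [hX hp hc] v1; have [pe po] := prev_od F t; split.
  move=> v10; apply: (@col_proj_all0 (od t)) => a.
  have [|ha] := boolP [exists i : 'I_m, (i <= t)%N && (a 0 (ev i) != (i == t)%:R)].
    case/existsP=> i /andP[it ai].
    have [x hx] : exists x, psi ((i == t)%:R * x) != psi (a 0 (ev i) * x).
      apply/existsP; rewrite -[X in is_true X]negbK negb_exists; apply/negP=> /forallP h.
      case/eqP: ai; apply/esym; apply: (addchar_scale_inj hpsi hpsi1) => x.
      by apply/eqP; move: (h x); rewrite negbK.
    have [ab uE] := colGL_uGL x it.
    apply: (col_proj_neq hpsi ab (x := psi ((i == t)%:R * x))).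
      rewrite -uE hX => [|i' j' h].
        rewrite /mxtrace (bigD1 i) //= big1 => [|l il].
          by rewrite !mxE eqxx addr0 mulrC.
        by rewrite !mxE (negPf il) mulr0.
      rewrite !mxE; case: (i' =P i) => [e|]; last by rewrite mulr0.
      case: (j' =P t) => [e'|]; last by rewrite mulr0.
      by move: h; rewrite e e' ltnn orbF ltnNge it.
    by rewrite -scalemxAr -colE !mxE [x * _]mulrC.
  have {}ha i : (i <= t)%N -> a 0 (ev i) = (i == t)%:R.
    move=> it; move: ha; rewrite negb_exists => /forallP/(_ i).
    by rewrite it negbK => /eqP.
  pose X : 'M[F]_m := \matrix_(i, j) (if (i == t) && (j < t)%N then - a 0 (od j) else 0).
  have hh : @lower_id F n (od t) (uGL X).
    apply: lower_id_uGL => i j; rewrite val_od mxE ltn_double => ti.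
    by rewrite -val_eqE gtn_eqF.
  have rX : rho (uGL X) *m v = 1 *: v.
    rewrite hX => [|i j h].
      rewrite /mxtrace big1 ?(addchar0 hpsi) // => i _; rewrite mxE -val_eqE /=.
      by case: ltngtP.
    rewrite mxE -val_eqE /=; case: (val i =P val t) => [/= e|//].
    by move: h; rewrite e ltnn /= => /ltnW; rewrite leqNgt => /negPf ->.
  apply: (col_proj_move hh (oner_neq0 _) rX).
  rewrite -[RHS]v10 /v1; congr (_ *m _); apply: col_proj_eq.
  have [me mo] := mul_uGL a X.
  elim/evodP => i; rewrite ?val_ev !val_od => it.
    by rewrite me ha ?pe // -leq_double -ltnS.
  have {}it : (i < t)%N by rewrite -ltn_double.
  rewrite mo po (bigD1 t) //= big1 => [|j jt]; last by rewrite mxE (negPf jt) mulr0.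
  by rewrite ha // eqxx mul1r mxE eqxx it addr0 subrr.
split.
- move=> X X0; apply: col_proj_stab.
  + apply: lower_id_uGL => i j; rewrite val_od ltn_double => ti.
    by rewrite X0 // ltnW.
  + by apply: hX => i j h; apply: X0; case/orP: h => /ltnW ->; rewrite ?orbT.
  + have [me mo] := mul_uGL (prev_row (od t)) X.
    elim/evodP => i _; rewrite ?me // mo big1 ?addr0 // => j _; rewrite pe.
    case: eqP => [->|]; last by rewrite mul0r.
    by rewrite X0 ?mulr0 // leqnn.
- move=> p p1; rewrite -[RHS]scale1r; apply: col_proj_stab.
  + apply: lower_id_dGL => i j; rewrite val_od ltnS leq_double => ti.
    by rewrite p1 // ti.
  + rewrite scale1r; apply: hp => i j; rewrite ltnS; exact: p1.
  + have [me mo] := mul_dGL (prev_row (od t)) p.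
    elim/evodP => i _.
      rewrite me pe (bigD1 t) //= pe eqxx mul1r big1 ?addr0 => [|j jt].
        by rewrite p1 ?leqnn // eq_sym.
      by rewrite pe (negPf jt) mul0r.
    by rewrite mo po big1 // => j _; rewrite po mul0r.
- move=> j; have [jt _|jt tj|/val_inj <- _] := ltngtP (od t) j.
  + by apply: col_equiv_proj => //; apply: hc; rewrite doubleS -val_od.
  + by move: jt; rewrite val_od ltnS leqNgt tj.
  + exact: col_equiv_self.
Qed.

(** Second half: the column [2t]. The even coordinates of an occurring character
    vanish because of the transvections in [dGL p]; the odd ones do not all
    vanish by cuspidality, and an element of [GL_t] moves them to a basis
    vector. *)
Lemma stage_full t v : (0 < t)%N -> shalika_half_stage t v ->
  let v1 := col_proj (ev t) (prev_row (ev t)) *m v in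
  (v1 = 0 -> v = 0) /\ shalika_stage t v1.
Proof.
move=> t0 [hX hp hc] v1; have [pe po] := prev_ev F t.
have lt' : (t.-1 < m)%N by rewrite (leq_ltn_trans (leq_pred _)).
pose t' : 'I_m := Ordinal lt'.
have tE : t = t'.+1 :> nat by rewrite /= prednK.
have {}po i : prev_row (ev t) 0 (od i) = (i == t')%:R by rewrite po tE eqSS.
have c0 : (0 < ev t)%N by rewrite val_ev double_gt0.
split.
  move=> v10; apply: (@col_proj_all0 (ev t)) => a.
  have [|ha] := boolP [exists i : 'I_m, (i < t)%N && (a 0 (ev i) != 0)].
    case/existsP=> i /andP[it ai].
    have [x hx] : exists x, psi (0 * x) != psi (a 0 (ev i) * x).
      apply/existsP; rewrite -[X in is_true X]negbK negb_exists; apply/negP=> /forallP h.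
      case/eqP: ai; apply/esym; apply: (addchar_scale_inj hpsi hpsi1) => x.
      by apply/eqP; move: (h x); rewrite negbK.
    have [ab1 ab2 dE] := colGL_dGL x it.
    apply: (col_proj_neq hpsi ab1 (x := 1)); last first.
      by rewrite -scalemxAr -colE !mxE -(addchar0 hpsi) -(mul0r x) [x * _]mulrC.
    have hv : rho (colGL (od t) (x *: delta_mx (od i) 0)) *m v = v.
      rewrite hc ?val_od //; have [_ po'] := prev_od F t.
      by rewrite -scalemxAr -colE mxE [col _ _ _ _]mxE po' mulr0 (addchar0 hpsi) scale1r.
    rewrite scale1r -{1}hv mulmxA -repGLM -dE; apply: hp => i' j' h.
    have [_ -> _] := transvP x it; rewrite !mxE big_ord1 !mxE !eqxx /= andbT.
    case: (i' =P i) => [e1|]; last by rewrite mulr0 mul0r addr0.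
    case: (j' =P t) => [e2|]; last by rewrite mulr0 addr0.
    by move: h; rewrite e1 e2 ltnn orbF leqNgt it.
  have {}ha i : (i < t)%N -> a 0 (ev i) = 0.
    move=> it; move: ha; rewrite negb_exists => /forallP/(_ i).
    by rewrite it negbK => /eqP.
  pose al : 'rV[F]_m := \row_j (if (j < t)%N then a 0 (od j) else 0).
  have [al0|] := eqVneq al 0.
    rewrite (@col_proj_eq _ _ _ _ _ _ _ _ 0).
      by apply: (cuspidal_col_proj hpsi) => // j; rewrite val_ev; apply: hc.
    elim/evodP => i; rewrite ?val_ev ?val_od => it; rewrite [RHS]mxE.
      by rewrite ha // -ltn_double.
    have {}it : (i < t)%N by rewrite -ltn_double ltnW.
    by move/rowP/(_ i): al0; rewrite !mxE it.
  case/rV0Pn=> i0 ai0.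
  have it0 : (i0 < t)%N by move: ai0; rewrite mxE; case: ltnP => //; rewrite eqxx.
  have [g [ge gi gj]] := GL_move_row t' ai0.
  have tt' : (t' < t)%N by rewrite tE.
  have gtr i j : (t <= i)%N -> GLval g i j = (i == j)%:R.
    by move=> ti; apply: gi; apply: contraTneq ti => ->; rewrite -ltnNge.
  have gtc i j : (t <= j)%N -> GLval g i j = (i == j)%:R.
    move=> tj; apply: gj; first by rewrite mxE ltnNge tj.
    by apply: contraTneq tj => ->; rewrite -ltnNge.
  have hh : @lower_id F n (ev t) (dGL g).
    by apply: lower_id_dGL => i j; rewrite val_ev => ti; apply: gtr; move: ti; lia.
  have rg : rho (dGL g) *m v = 1 *: v.
    by rewrite scale1r; apply: hp => i j /orP[/gtr //|/ltnW /gtc].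
  apply: (col_proj_move hh (oner_neq0 _) rg).
  rewrite -[RHS]v10 /v1; congr (_ *m _); apply: col_proj_eq.
  have [me mo] := mul_dGL a g.
  elim/evodP => i; rewrite val_ev ?val_ev ?val_od => it.
    have {}it : (i < t)%N by rewrite -ltn_double.
    rewrite me pe big1 // => j _; have [jt|tj] := ltnP j t; first by rewrite ha ?mul0r.
    by rewrite gtr // -val_eqE gtn_eqF ?mulr0 // (leq_trans it).
  have {}it : (i < t)%N by rewrite -ltn_double ltnW.
  rewrite mo po; move/rowP/(_ i): ge; rewrite !mxE eqxx => <-.
  apply: eq_bigr => j _; rewrite [in RHS]mxE; case: ltnP => // tj.
  by rewrite gtr // -val_eqE gtn_eqF ?mulr0 ?mul0r // (leq_trans it).
split.
- move=> X X0; apply: col_proj_stab; last first.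
  + have [me mo] := mul_uGL (prev_row (ev t)) X.
    elim/evodP => i _; rewrite ?me // mo big1 ?addr0 // => j _.
    by rewrite pe mul0r.
  + exact: hX.
  + by apply: lower_id_uGL => i j; rewrite val_ev leq_double => ti; rewrite X0 // ti.
- move=> p p1; rewrite -[RHS]scale1r; apply: col_proj_stab.
  + apply: lower_id_dGL => i j; rewrite val_ev => ti; rewrite p1 //.
    by apply/orP; left; move: ti; lia.
  + rewrite scale1r; apply: hp => i j h; apply: p1.
    by case/orP: h => [/leqW ->|/ltnW ->]; rewrite ?orbT.
  + have [me mo] := mul_dGL (prev_row (ev t)) p.
    elim/evodP => i _; first by rewrite me pe big1 // => j _; rewrite pe mul0r.
    rewrite mo po (bigD1 t') //= po eqxx mul1r big1 ?addr0 => [|j jt].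
      by rewrite p1 ?tE ?leqnn // eq_sym.
    by rewrite po (negPf jt) mul0r.
- move=> j; have [jt _|jt tj|/val_inj <- _] := ltngtP (ev t) j.
  + by apply: col_equiv_proj => //; apply: hc; rewrite -val_ev.
  + by move: jt; rewrite val_ev ltnNge tj.
  + exact: col_equiv_self.
Qed.

(** Projecting along the columns one after the other does not lose the vector,
    nor does it create a Whittaker projection; at the end of the process the
    vector is its own Whittaker projection. *)
Lemma shalika_stage_eq0 s v : (s <= m)%N -> shalika_stage s v -> E *m v = 0 -> v = 0.
Proof.
elim: s v => [|s IH] v sm st Ev.
  by rewrite -Ev (col_equiv_whittaker hpsi) // => j; case: st => _ _ h; apply: h.
pose t : 'I_m := Ordinal sm.
have [v0 half] := stage_half (t := t) st.
set v1 := (_ *m v) in v0 half.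
have Ev1 : E *m v1 = 0 by apply: (whittaker_col_proj hpsi).
apply: v0; have [t0|s0] := posnP s; last first.
  have [v10 st2] := stage_full (t := t) s0 half.
  by apply: v10; apply: IH; [exact: ltnW|exact: st2|exact: (whittaker_col_proj hpsi)].
rewrite -[LHS](col_equiv_whittaker hpsi (rho := rho)) // => j.
have [_ _ h] := half; have [j0|j0] := posnP j; last by apply: h; rewrite /= t0.
move=> z zj; have -> : z = 0.
  by apply/colP=> l; move/aboveP: zj => ->; rewrite ?j0 // mxE.
by rewrite colGL0 repGL1 mul1mx mulmx0 mxE (addchar0 hpsi) scale1r.
Qed.

(** As the Whittaker projection has rank one, this bounds the dimension of the
    space of Shalika vectors for the mirabolic by one. *)
Lemma shalika_vector_eq0 (w : 'cV[R[i]]_d) :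
  (forall X, rho (shearGL X) *m w = psi (\tr X) *: w) ->
  (forall p, (forall j, GLval p ord_max j = (ord_max == j)%:R) ->
    rho (doubleGL p) *m w = w) ->
  E *m (rho sg *m w) = 0 -> w = 0.
Proof.
move=> hX hp Ew.
have rw (g : GL) : rho (sg * g * sg^-1)%g *m (rho sg *m w) = rho sg *m (rho g *m w).
  by rewrite mulmxA -repGLM mulgKV repGLM mulmxA.
have : rho sg *m w = 0.
  apply: (@shalika_stage_eq0 m) => //; split.
  - by move=> X _; rewrite rw hX scalemxAr.
  - by move=> p p1; rewrite rw hp // => j; rewrite p1 // ltnSn.
  - by move=> j; rewrite -addnn leqNgt ltn_ord.
move/(congr1 (mulmx (rho (sg^-1)%g))).
by rewrite mulmxA -repGLM mulVg repGL1 mul1mx mulmx0.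
Qed.

End ShalikaVectors.

(** * Unfolding the sums over cosets *)

Lemma sum_rcosets_repr (C : numFieldType) (gT : finGroupType) (H G : {group gT}) (f : gT -> C) :
  H \subset G -> (forall h x, h \in H -> f (h * x)%g = f x) ->
  \sum_(Hx in rcosets H G) f (repr Hx) = #|H|%:R^-1 * \sum_(x in G) f x.
Proof.
move=> sHG hf; rewrite (set_partition_big _ (rcosets_partition sHG)) /=.
rewrite mulr_sumr; apply: eq_bigr => _ /rcosetsP[x _ ->].
have e y : y \in H :* x -> f y = f (repr (H :* x)).
  by rewrite -{1}(rcoset_repr H x) => /rcosetP[h hH ->]; rewrite hf.
rewrite (eq_bigr _ e) sumr_const card_rcoset -[f _ *+ _]mulr_natl mulKf //.
by rewrite pnatr_eq0 -lt0n cardG_gt0.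
Qed.

Section UpperTriangular.
Variables (F : finFieldType) (k : nat).
Local Notation m := k.+1.

Lemma upper_triangularP (X : 'M[F]_m) :
  reflect (forall i j : 'I_m, (j < i)%N -> X i j = 0) (X \in upper_triangular F m).
Proof.
rewrite inE; apply: (iffP forallP) => h i.
  by move=> j ji; have /forallP/(_ j)/implyP/(_ ji)/eqP := h i.
by apply/forallP=> j; apply/implyP=> ji; rewrite h.
Qed.

Lemma group_set_upper_triangular : group_set (upper_triangular F m).
Proof.
apply/group_setP; split=> [|X Y /upper_triangularP hX /upper_triangularP hY].
  by apply/upper_triangularP => i j _; rewrite mxE.
by apply/upper_triangularP => i j ji; rewrite mxE hX // hY // addr0.
Qed.

Canonical upper_triangular_group := Group group_set_upper_triangular.

Lemma superdiag_sum_evod (A : 'M[F]_(m + m)) :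
  (forall i j, A (od i) (ev j) = 0) -> superdiag_sum A = \sum_i A (ev i) (od i).
Proof.
move=> A0; rewrite /superdiag_sum sum_evod [X in _ + X]big1 ?addr0 => [|i _].
  apply: eq_bigr => i _; apply: big_pred1 => j.
  rewrite val_ev -[RHS]/(j == od i); apply/eqP/eqP => [e|->]; last exact: val_od.
  by apply: val_inj; rewrite [LHS]e [RHS]val_od.
rewrite big1 //; elim/evodP => j; first by rewrite A0.
by rewrite !val_od => /eqP[/(congr1 odd)]; rewrite /= !odd_double.
Qed.

Lemma uGL_unip (X : 'M[F]_m) : X \in upper_triangular F m ->
  uGL X \in unip F (m + m) /\ superdiag_sum (uGL X) = \tr X.
Proof.
move=> /upper_triangularP hX; have [ee eo oe oo] := uGLE X; split; last first.
  by rewrite superdiag_sum_evod //; apply: eq_bigr => i _; rewrite eo.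
apply/(@unipP F (k + k.+1)); elim/evodP => i; elim/evodP => j.
- by rewrite ee (inj_eq (@ev_inj k)).
- rewrite eo ev_od val_ev val_od ltn_double; exact: hX.
- by rewrite oe od_ev.
- by rewrite oo (inj_eq (@od_inj k)).
Qed.

Lemma dGL_unip (p : {'GL_m[F]}) : p \in unip F m ->
  dGL p \in unip F (m + m) /\ superdiag_sum (dGL p) = 0.
Proof.
move=> /unipP hp; have [ee eo oe oo] := dGLE p; split; last first.
  by rewrite superdiag_sum_evod // big1.
apply/(@unipP F (k + k.+1)); elim/evodP => i; elim/evodP => j.
- rewrite ee (inj_eq (@ev_inj k)) !val_ev leq_double; exact: hp.
- by rewrite eo ev_od.
- by rewrite oe od_ev.
- rewrite oo (inj_eq (@od_inj k)) !val_od ltnS leq_double; exact: hp.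
Qed.

Lemma val_shearGL (X : 'M[F]_m) : GLval (shearGL X) = block_mx 1%:M X 0 1%:M.
Proof. by []. Qed.

Lemma val_doubleGL (p : {'GL_m[F]}) :
  GLval (doubleGL p) = block_mx (GLval p) 0 0 (GLval p).
Proof. by []. Qed.

Lemma GL_blockM (g h : {'GL_(m + m)[F]}) (A B C D A' B' C' D' : 'M[F]_m) :
  GLval g = block_mx A B C D -> GLval h = block_mx A' B' C' D' ->
  GLval (g * h)%g = block_mx (A *m A' + B *m C') (A *m B' + B *m D')
    (C *m A' + D *m C') (C *m B' + D *m D').
Proof. by move=> eg eh; rewrite -mulmx_block -eg -eh GL_MxE. Qed.

Lemma shearGLD (X Y : 'M[F]_m) : shearGL (X + Y) = (shearGL X * shearGL Y)%g.
Proof.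
apply: (@GL_eqP F (k + k.+1)); rewrite (GL_blockM (val_shearGL X) (val_shearGL Y)).
by rewrite val_shearGL !mulmx1 !mul1mx !mulmx0 !mul0mx !addr0 add0r addrC.
Qed.

Lemma doubleGLM (p g : {'GL_m[F]}) : doubleGL (p * g)%g = (doubleGL p * doubleGL g)%g.
Proof.
apply: (@GL_eqP F (k + k.+1)); rewrite (GL_blockM (val_doubleGL p) (val_doubleGL g)).
by rewrite val_doubleGL !mulmx0 !mul0mx !addr0 add0r GL_MxE.
Qed.

Definition conjM (p : {'GL_m[F]}) (X : 'M[F]_m) := GLval p *m X *m invmx (GLval p).

Lemma double_shearGL (p : {'GL_m[F]}) X :
  (doubleGL p * shearGL X)%g = (shearGL (conjM p X) * doubleGL p)%g.
Proof.
apply: (@GL_eqP F (k + k.+1)); rewrite (GL_blockM (val_doubleGL p) (val_shearGL X)).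
rewrite (GL_blockM (val_shearGL _) (val_doubleGL p)).
rewrite !mulmx1 !mul1mx !mulmx0 !mul0mx !addr0 !add0r.
by rewrite mulmxKV ?GLval_unitmx.
Qed.

Lemma conjM_inj p : injective (conjM p).
Proof.
move=> X Y /(can_inj (mulmxKV (GLval_unitmx p))).
exact: (can_inj (mulKmx (GLval_unitmx p))).
Qed.

Lemma tr_conjM p X : \tr (conjM p X) = \tr X.
Proof. by rewrite mxtrace_mulC mulmxA mulVmx ?GLval_unitmx // mul1mx. Qed.

End UpperTriangular.

Section Unfolding.
Variables (R : realType) (F : finFieldType) (k : nat).
Local Notation m := k.+1.
Local Notation GL := {'GL_(m + m)[F]}.
Local Notation sg := (sigmaGL F k).

Definition JS_const : R[i] :=
  (#|'GL_m[F] : unip F m|%:R * #|[set: 'M[F]_m] : upper_triangular F m|%:R)^-1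
  * (#|unip F m|%:R^-1 * #|upper_triangular F m|%:R^-1).

(** The summand is invariant in [X] because [sg] carries upper triangular [B] to
    a unipotent matrix with superdiagonal sum [tr B]; the inner sum is then
    invariant in [g] because [sg] carries the diagonal copy of a unipotent
    matrix to one with vanishing superdiagonal. *)
Lemma JS_unfold (psi : F -> R[i]) (W : GL -> R[i]) phi : is_addchar psi ->
  (forall (u g : GL), u \in unip F (m + m) -> W (u * g)%g = psi (superdiag_sum u) * W g) ->
  JS psi W phi = JS_const * \sum_(g : {'GL_m[F]}) \sum_X
    W (sg * shearGL X * doubleGL g)%g * psi (- \tr X) * phi (eps F k *m GLval g).
Proof.
move=> hpsi hW; rewrite /JS /JS_const -mulrA; congr (_ * _).
pose f (g : {'GL_m[F]}) (X : 'M[F]_m) : R[i] :=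
  W (sg * shearGL X * doubleGL g)%g * psi (- \tr X) * phi (eps F k *m GLval g).
have fB g B X : B \in upper_triangular F m -> f g (B + X) = f g X.
  move=> hB; have [uN us] := uGL_unip hB; rewrite /f shearGLD.
  have -> : (sg * (shearGL B * shearGL X) * doubleGL g =
             uGL B * (sg * shearGL X * doubleGL g))%g by rewrite /uGL !mulgA mulgKV.
  rewrite hW // us raddfD opprD (addcharD hpsi) (addcharN hpsi (\tr B)) -/(psi _).
  by congr (_ * _); rewrite mulrACA divff ?mul1r ?(addchar_neq0 hpsi).
pose h (g : {'GL_m[F]}) := \sum_X f g X.
have hN (p g : {'GL_m[F]}) : p \in unip F m -> h (p * g)%g = h g.
  move=> pN; have [uN us] := dGL_unip pN.
  rewrite /h (reindex_inj (@conjM_inj F k p)); apply: eq_bigr => X _; rewrite /f.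
  have -> : (sg * shearGL (conjM p X) * doubleGL (p * g) =
             dGL p * (sg * shearGL X * doubleGL g))%g.
    by rewrite doubleGLM !mulgA -(mulgA sg) -double_shearGL /dGL !mulgA mulgKV.
  rewrite hW // us (addchar0 hpsi) mul1r tr_conjM GL_MxE mulmxA.
  congr (_ * phi (_ *m _)); rewrite -rowE; apply/rowP => j.
  by move/unipP: pN => hp; rewrite !mxE hp ?leq_ord // eqxx eq_sym.
transitivity (\sum_(Ng in rcosets (unip F m) 'GL_m[F])
   (#|upper_triangular F m|%:R^-1 * h (repr Ng))).
  apply: eq_bigr => Ng _.
  rewrite (@sum_rcosets_repr _ _ (upper_triangular_group F k) [set: 'M[F]_m]%G (f (repr Ng))).
  - by congr (_ * _); apply: eq_bigl => X; rewrite inE.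
  - exact: subsetT.
  - by move=> B X hB; apply: fB.
rewrite -mulr_sumr [_^-1 * _^-1]mulrC -mulrA; congr (_ * _).
rewrite (@sum_rcosets_repr _ _ (unip_group F k) [set: {'GL_m[F]}]%G h).
- by congr (_ * _); apply: eq_bigl => X; rewrite inE.
- exact: subsetT.
- exact: hN.
Qed.

End Unfolding.

(** * Duality on the Shalika subgroup *)

Section DualUnfolding.
Variables (F : finFieldType) (k : nat).
Local Notation m := k.+1.
Local Notation GL := {'GL_(m + m)[F]}.
Local Notation sg := (sigmaGL F k).
Local Notation wl := (antidiagGL F k).
Local Notation sw := (swapGL F k).

Definition trinv (g : {'GL_m[F]}) : {'GL_m[F]} := GLof (invmx (GLval g))^T.

Lemma val_trinv g : GLval (trinv g) = (invmx (GLval g))^T.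
Proof. by rewrite val_GLof // unitmx_tr unitmx_inv GLval_unitmx. Qed.

Lemma trinvM g h : trinv (g * h)%g = (trinv g * trinv h)%g.
Proof.
apply: GL_eqP; rewrite GL_MxE !val_trinv -trmx_mul -!GL_VxE.
by rewrite invMg GL_MxE.
Qed.

Lemma trinvK : involutive trinv.
Proof. by move=> g; apply: GL_eqP; rewrite !val_trinv -trmx_inv invmxK trmxK. Qed.

Definition antidiag : {'GL_m[F]} := GLof (antidiag_mx F m).

Lemma val_antidiag : GLval antidiag = antidiag_mx F m.
Proof. by rewrite val_GLof // antidiag_mx_unit. Qed.

Lemma val_invtrGL (g : GL) : GLval (invtrGL g) = (invmx (GLval g))^T.
Proof. by []. Qed.

Lemma invtrGLM (g h : GL) : invtrGL (g * h)%g = (invtrGL g * invtrGL h)%g.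
Proof.
apply: (@GL_eqP F (k + k.+1)); rewrite GL_MxE !val_invtrGL -trmx_mul -!GL_VxE.
by rewrite invMg GL_MxE.
Qed.

Lemma val_swapGL : GLval sw = block_mx (0 : 'M[F]_m) 1%:M 1%:M 0.
Proof. by []. Qed.

Lemma swapGLK : (sw * sw = 1)%g.
Proof.
apply: (@GL_eqP F (k + k.+1)); rewrite (GL_blockM val_swapGL val_swapGL) GL_1E.
rewrite !mulmx0 !mul0mx !mulmx1 !addr0 !add0r.
exact: (esym (@scalar_mx_block F m m 1)).
Qed.

Lemma invtrGL_uniq (g h : GL) : GLval g *m (GLval h)^T = 1%:M -> invtrGL g = h.
Proof.
move=> e; apply: (@GL_eqP F (k + k.+1)); rewrite val_invtrGL.
apply: (can_inj (@trmxK _ _ _)); rewrite trmxK.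
apply: (can_inj (mulKmx (GLval_unitmx g))).
by rewrite mulmxV ?GLval_unitmx.
Qed.

Lemma invtrGL_block (g h : GL) (A B C D A' B' C' D' : 'M[F]_m) :
  GLval g = block_mx A B C D -> GLval h = block_mx A' B' C' D' ->
  [/\ A *m A'^T + B *m B'^T = 1%:M, A *m C'^T + B *m D'^T = 0,
      C *m A'^T + D *m B'^T = 0 & C *m C'^T + D *m D'^T = 1%:M] ->
  invtrGL g = h.
Proof.
move=> eg eh [e1 e2 e3 e4]; apply: invtrGL_uniq.
have e : block_mx A B C D *m (block_mx A' B' C' D')^T = 1%:M.
  by rewrite tr_block_mx mulmx_block e1 e2 e3 e4 -scalar_mx_block.
by rewrite eg eh; exact: e.
Qed.

Lemma invtrGL_swap : invtrGL sw = sw.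
Proof.
apply: (invtrGL_block val_swapGL val_swapGL).
by rewrite !trmx0 !trmx1 !mulmx0 !mul0mx !mulmx1 !addr0 !add0r.
Qed.

Lemma invtrGL_shear (X : 'M[F]_m) :
  invtrGL (shearGL X) = (sw * shearGL (- X^T) * sw)%g.
Proof.
apply: (invtrGL_block (val_shearGL X)).
  exact: (GL_blockM (GL_blockM val_swapGL (val_shearGL _)) val_swapGL).
rewrite !mulmx0 !mul0mx !mulmx1 !mul1mx !addr0 !add0r.
rewrite ?mulmx0 ?addr0 ?add0r trmx0 trmx1 linearN /= trmxK.
by rewrite !mulmx0 !mulmx1 ?mul0mx ?mul1mx ?addr0 ?add0r addNr.
Qed.

Lemma invtrGL_double (g : {'GL_m[F]}) : invtrGL (doubleGL g) = doubleGL (trinv g).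
Proof.
apply: (invtrGL_block (val_doubleGL g) (val_doubleGL _)).
rewrite val_trinv trmxK trmx0 !mulmx0 !mul0mx !addr0 !add0r.
by rewrite mulmxV ?GLval_unitmx.
Qed.

Lemma double_swap (g : {'GL_m[F]}) : (doubleGL g * sw = sw * doubleGL g)%g.
Proof.
apply: (@GL_eqP F (k + k.+1)).
rewrite (GL_blockM (val_doubleGL g) val_swapGL) (GL_blockM val_swapGL (val_doubleGL g)).
by rewrite !mulmx0 !mul0mx !mulmx1 !mul1mx !addr0 !add0r.
Qed.

Lemma sigma_mulE (A : 'M[F]_(m + m)) a b :
  (sigma_mx F k *m A) (sigma_ord a) b = A a b.
Proof.
rewrite /sigma_mx tr_perm_mx -row_permE mxE.
by rewrite -[sigma_ord a](permE (@sigma_ord_inj k)) permK.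
Qed.

Lemma antidiag_mulE n p (A : 'M[F]_(n, p)) i j :
  (antidiag_mx F n *m A) i j = A (rev_ord i) j.
Proof.
rewrite mxE (bigD1 (rev_ord i)) //= mxE rev_ordK eqxx mul1r big1 ?addr0 // => l li.
rewrite mxE; case: eqP => [e|]; rewrite ?mul0r //.
by move: li; rewrite e rev_ordK eqxx.
Qed.

Lemma rev_ev (i : 'I_m) : rev_ord (ev i) = od (rev_ord i).
Proof.
apply: val_inj; rewrite [RHS]val_od -[LHS]/(m + m - (ev i).+1)%N val_ev /=.
by have := ltn_ord i; lia.
Qed.

Lemma rev_od (i : 'I_m) : rev_ord (od i) = ev (rev_ord i).
Proof. by apply: rev_ord_inj; rewrite rev_ordK rev_ev rev_ordK. Qed.

Lemma antidiag_sigma_swap : (wl * invtrGL sg * sw = sg * doubleGL antidiag)%g.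
Proof.
have -> : invtrGL sg = sg.
  by apply: invtrGL_uniq; rewrite /= /sigma_mx trmxK tr_perm_mx -perm_mxM mulVg perm_mx1.
apply: (@GL_eqP F (k + k.+1)); rewrite !GL_MxE.
suff e : antidiag_mx F (m + m) *m (sigma_mx F k *m block_mx 0 1%:M 1%:M 0) =
         sigma_mx F k *m block_mx (antidiag_mx F m) 0 0 (antidiag_mx F m).
  by rewrite -mulmxA val_doubleGL val_antidiag; exact: e.
apply/matrixP; elim/evodP => i j; rewrite antidiag_mulE sigma_mulE.
  rewrite rev_ev sigma_mulE; case: (split_ordP j) => j' ->.
    by rewrite block_mxEdl block_mxEul !mxE -(inj_eq rev_ord_inj) rev_ordK.
  by rewrite block_mxEdr block_mxEur !mxE.
rewrite rev_od sigma_mulE; case: (split_ordP j) => j' ->.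
  by rewrite block_mxEdl block_mxEul !mxE.
by rewrite block_mxEdr block_mxEur !mxE -(inj_eq rev_ord_inj) rev_ordK.
Qed.

(** Inverse transposition turns an upper shear into a lower one, which the swap
    of the two blocks turns back; moved across [sg], the long permutation matrix
    [wl] becomes two diagonal copies of that of [GL_m]. *)
Lemma dual_shalika (X : 'M[F]_m) (g : {'GL_m[F]}) :
  (wl * invtrGL (sg * shearGL X * doubleGL g * sw) =
   sg * shearGL (conjM antidiag (- X^T)) * doubleGL (antidiag * trinv g))%g.
Proof.
rewrite !invtrGLM invtrGL_shear invtrGL_double invtrGL_swap.
rewrite doubleGLM !mulgA antidiag_sigma_swap.
rewrite -!mulgA; congr (sg * _)%g; rewrite double_swap (mulgA sw sw) swapGLK mul1g.
by rewrite !mulgA double_shearGL.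
Qed.

Lemma mul_antidiagE n p (A : 'M[F]_(p, n)) i j :
  (A *m antidiag_mx F n) i j = A i (rev_ord j).
Proof.
rewrite mxE (bigD1 (rev_ord j)) //= mxE eqxx mulr1 big1 ?addr0 // => l li.
by rewrite mxE (negPf li) mulr0.
Qed.

Lemma antidiag_invtr (u : GL) :
  (wl * invtrGL u = @antitr F (k + k.+1) (u^-1)%g * wl)%g.
Proof.
apply: (@GL_eqP F (k + k.+1)); rewrite !GL_MxE val_invtrGL.
rewrite -[GLval wl]/(antidiag_mx F (k + k.+1).+1); apply/matrixP => i j.
rewrite antidiag_mulE mul_antidiagE antitrE rev_ordK mxE; congr (fun_of_matrix _ _ _).
Qed.

End DualUnfolding.

Section DualUnfoldingSum.
Variables (R : realType) (F : finFieldType) (k : nat).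
Local Notation m := k.+1.
Local Notation GL := {'GL_(m + m)[F]}.
Local Notation sg := (sigmaGL F k).

Definition dual_param (g : {'GL_m[F]}) : {'GL_m[F]} := trinv ((antidiag F k)^-1 * g)%g.

(** After the change of variables of [dual_shalika] the dual form is the sum of
    the original one: only the argument of the test function, which moves in the
    contragredient orbit, has changed. *)
Lemma JSdual_unfold (psi : F -> R[i]) (W : GL -> R[i]) phi : is_addchar psi ->
  (forall (u g : GL), u \in unip F (m + m) -> W (u * g)%g = psi (superdiag_sum u) * W g) ->
  JSdual psi W phi = JS_const R F k * \sum_(g : {'GL_m[F]}) \sum_X
    W (sg * shearGL X * doubleGL g)%g * psi (- \tr X)
     * fourier psi phi (eps F k *m GLval (dual_param g)).
Proof.
move=> hpsi hW; rewrite /JSdual (JS_unfold _ (inv_addchar hpsi)); last first.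
  move=> u g un; rewrite /rtranslate /tildeW -mulgA (invtrGLM u) mulgA.
  rewrite (antidiag_invtr u) -mulgA.
  have vn : @antitr F (k + k.+1) (u^-1)%g \in unip F (k + k.+1).+1.
    by rewrite antitr_unip groupV.
  rewrite (hW (antitr (u^-1)%g) _ vn).
  congr (_ * _); rewrite /inv_char -(addcharN hpsi); congr (psi _).
  by rewrite -(superdiag_sum_unipV un); exact: superdiag_sum_antitr.
congr (_ * _).
pose w0 := antidiag F k.
have inj1 : injective (fun g => w0 * trinv g)%g.
  by move=> g h /mulgI /(can_inj (@trinvK F k)).
have inj2 : injective (fun X => conjM w0 (- X^T)).
  by move=> X Y /conjM_inj /oppr_inj /trmx_inj.
rewrite [RHS](reindex_inj inj1); apply: eq_bigr => g _.
rewrite [RHS](reindex_inj inj2); apply: eq_bigr => X _.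
rewrite /rtranslate /tildeW dual_shalika tr_conjM linearN /= mxtrace_tr opprK.
have -> : dual_param (w0 * trinv g)%g = g by rewrite /dual_param mulKg trinvK.
by rewrite /inv_char (addcharN hpsi) invrK.
Qed.

End DualUnfoldingSum.

(** * Uniqueness of Whittaker functionals *)

Section WhittakerUnique.
Variables (R : realType) (F : finFieldType) (psi : F -> R[i]).
Hypotheses (hpsi : is_addchar psi) (hpsi1 : nontrivial_char psi).
Variables (n d : nat) (rho : mx_representation R[i] 'GL_n.+1[F] d).
Hypothesis rho_irr : mx_irreducible rho.
Local Notation E := (@whittaker_proj R F psi n d rho).
Local Notation N := (unip F n.+1).
Implicit Types (ell : 'rV[R[i]]_d) (u g v : {'GL_n.+1[F]}).

Lemma whittaker_functionalE ell :
  whittaker_functional rho psi ell <->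
  forall u, u \in N -> ell *m rho u = whittaker_char psi u *: ell.
Proof.
split=> h u un; last by move=> v; rewrite mulmxA h // -scalemxAl mxE.
apply/rowP=> j; have := h u un (delta_mx j 0).
by rewrite mulmxA -!colE !mxE.
Qed.

Lemma whittaker_functional_proj ell :
  whittaker_functional rho psi ell <-> ell *m E = ell.
Proof.
have H := char_proj_row rho (@mem_GL F n) (whittaker_char1 hpsi n) (@whittaker_charM R F psi hpsi n) ell.
split=> [/whittaker_functionalE/H //|/H e]; exact/whittaker_functionalE.
Qed.

Lemma whittaker_proj_idem : E *m E = E.
Proof.
exact: (char_proj_idem rho (@mem_GL F n) (whittaker_char1 hpsi n) (@whittaker_charM R F psi hpsi n)).
Qed.

Lemma whittaker_functional_exists : E != 0 ->
  exists2 ell : 'rV_d, ell != 0 & whittaker_functional rho psi ell.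
Proof.
case/matrix0Pn=> i [j Eij]; exists (row i E).
  by apply/rV0Pn; exists j; rewrite mxE.
by apply/whittaker_functional_proj; rewrite -row_mul whittaker_proj_idem.
Qed.

Lemma whittaker_char_biequivariant (f : {'GL_n.+1[F]} -> R[i]) :
  (forall u g v, u \in N -> v \in N ->
     f (u * g * v)%g = whittaker_char psi u * f g * whittaker_char psi v) ->
  forall g, f (antitr g) = f g.
Proof. by move=> hf g; apply: (biequivariant_antitr hpsi hpsi1). Qed.

Lemma whittaker_char_antitr u : whittaker_char psi (antitr u) = whittaker_char psi u.
Proof. by rewrite /whittaker_char superdiag_sum_antitr. Qed.

(** Multiplicity one for the Whittaker model, from the anti-involution
    [antitr] by Gelfand's trick. *)
Lemma whittaker_proj_rank1 ell0 : ell0 != 0 -> whittaker_functional rho psi ell0 ->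
  exists v0 : 'cV[R[i]]_d, E = v0 *m ell0.
Proof.
move=> nz /whittaker_functional_proj w0.
exact: (char_proj_rank1 (@mem_GL F n) (whittaker_char1 hpsi n) (@whittaker_charM R F psi hpsi n)
  (@antitrM F n) (@antitrK F n) (@antitr_unip F n) whittaker_char_antitr
  whittaker_char_biequivariant rho_irr nz w0).
Qed.

Lemma whittaker_unique ell0 ell : ell0 != 0 -> whittaker_functional rho psi ell0 ->
  whittaker_functional rho psi ell -> exists a, ell = a *: ell0.
Proof.
move=> nz w0 /whittaker_functional_proj w1.
have [v0 Ev] := whittaker_proj_rank1 nz w0.
exists ((ell *m v0) 0 0); rewrite -[LHS]w1 Ev mulmxA [ell *m v0]mx11_scalar.
by rewrite mul_scalar_mx !mxE.
Qed.

End WhittakerUnique.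

(** * Shalika functionals and the two bilinear forms *)

Section ShalikaForms.
Variables (R : realType) (F : finFieldType) (psi : F -> R[i]).
Hypotheses (hpsi : is_addchar psi) (hpsi1 : nontrivial_char psi).
Variables (k d : nat).
Local Notation m := k.+1.
Local Notation C := R[i].
Variable rho : mx_representation C 'GL_(k.+1 + k.+1)[F] d.
Hypothesis rho_irr : mx_irreducible rho.
Hypothesis rho_cusp : cuspidal rho.
Local Notation sg := (sigmaGL F k).
Local Notation eps := (eps F k).
Local Notation E := (@whittaker_proj R F psi (k + k.+1) d rho).
Implicit Types (X : 'M[F]_m) (g h p : {'GL_m[F]}) (x y : 'rV[F]_m) (phi f : 'rV[F]_m -> C).
Implicit Types (ell : 'rV[C]_d).

Definition rshear X : 'M[C]_d := rho (shearGL X).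
Definition rdouble g : 'M[C]_d := rho (doubleGL g).

Lemma rshearD X Y : rshear (X + Y) = rshear X *m rshear Y.
Proof. by rewrite /rshear shearGLD; exact: repGLM. Qed.

Lemma rdoubleM g h : rdouble (g * h)%g = rdouble g *m rdouble h.
Proof. by rewrite /rdouble doubleGLM; exact: repGLM. Qed.

Lemma rdouble_rshear g X : rdouble g *m rshear X = rshear (conjM g X) *m rdouble g.
Proof.
rewrite /rdouble /rshear -[LHS](repGLM rho (doubleGL g) (shearGL X)).
by rewrite double_shearGL; exact: repGLM.
Qed.

(** The projection onto the [psi]-equivariant vectors of the unipotent radical of
    the Shalika subgroup, up to a scalar. *)
Definition shear_proj : 'M[C]_d := \sum_X psi (- \tr X) *: rshear X.

Lemma shear_projMr X : shear_proj *m rshear X = psi (\tr X) *: shear_proj.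
Proof.
rewrite mulmx_suml [LHS](reindex_inj (addIr (- X))) scaler_sumr.
apply: eq_bigr => Y _; rewrite -scalemxAl -rshearD subrK scalerA -(addcharD hpsi).
by rewrite raddfB opprB.
Qed.

Lemma shear_projMl X : rshear X *m shear_proj = psi (\tr X) *: shear_proj.
Proof.
rewrite -shear_projMr mulmx_suml mulmx_sumr; apply: eq_bigr => Y _.
by rewrite -scalemxAr -scalemxAl -!rshearD addrC.
Qed.

Lemma rdouble_shear_proj g : rdouble g *m shear_proj = shear_proj *m rdouble g.
Proof.
rewrite mulmx_sumr mulmx_suml [RHS](reindex_inj (@conjM_inj F k g)).
by apply: eq_bigr => X _; rewrite -scalemxAr -scalemxAl rdouble_rshear tr_conjM.
Qed.

(** The test function enters the two forms only through these operators, which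
    are applied to the same row. *)
Definition fun_op phi : 'M[C]_d := \sum_(g : {'GL_m[F]}) phi (eps *m GLval g) *: rdouble g.

Definition dual_fun_op f : 'M[C]_d := 
  \sum_(g : {'GL_m[F]}) f (eps *m GLval (dual_param g)) *: rdouble g.

Lemma fun_op_rdouble phi h :
  fun_op phi *m rdouble h = fun_op (fun x => phi (x *m invmx (GLval h))).
Proof.
rewrite mulmx_suml [RHS](reindex_inj (mulIg h)).
apply: eq_bigr => g _; rewrite -scalemxAl rdoubleM; congr (phi _ *: _).
by rewrite GL_MxE mulmxA mulmxK ?GLval_unitmx.
Qed.

Lemma dual_fun_op_rdouble f h :
  dual_fun_op f *m rdouble h = dual_fun_op (fun y => f (y *m (GLval h)^T)).
Proof.
rewrite mulmx_suml [RHS](reindex_inj (mulIg h)).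
apply: eq_bigr => g _; rewrite -scalemxAl rdoubleM; congr (f _ *: _).
rewrite -mulmxA; congr (_ *m _).
rewrite /dual_param mulgA (trinvM (_ * g)) [in RHS]GL_MxE (val_trinv h) -mulmxA.
by rewrite -trmx_mul mulmxV ?GLval_unitmx // trmx1 mulmx1.
Qed.

Lemma eq_fun_op phi phi' : phi =1 phi' -> fun_op phi = fun_op phi'.
Proof. by move=> e; apply: eq_bigr => g _; rewrite e. Qed.

Lemma eq_dual_fun_op f f' : f =1 f' -> dual_fun_op f = dual_fun_op f'.
Proof. by move=> e; apply: eq_bigr => g _; rewrite e. Qed.

Definition ind x : 'rV[F]_m -> C := fun y => (y == x)%:R.

Lemma sum_ind phi y : \sum_x phi x * ind x y = phi y.
Proof.
rewrite (bigD1 y) //= /ind eqxx mulr1 big1 ?addr0 // => x xy.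
by rewrite eq_sym (negPf xy) mulr0.
Qed.

Lemma fun_op_sum phi : fun_op phi = \sum_x phi x *: fun_op (ind x).
Proof.
under [RHS]eq_bigr do rewrite scaler_sumr; rewrite exchange_big /=.
apply: eq_bigr => g _; rewrite -[in LHS](sum_ind phi) scaler_suml.
by apply: eq_bigr => x _; rewrite scalerA.
Qed.

Lemma eps_neq0 : eps != 0.
Proof.
by apply/rV0Pn; exists ord_max; rewrite mxE !eqxx oner_eq0.
Qed.

Lemma eps_GL_neq0 g : eps *m GLval g != 0.
Proof.
apply: contra eps_neq0 => /eqP e.
by rewrite -(mulmxK (GLval_unitmx g) eps) e mul0mx.
Qed.

Lemma fun_op_ind0 : fun_op (ind 0) = 0.
Proof.
by apply: big1 => g _; rewrite /ind (negPf (eps_GL_neq0 g)) scale0r.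
Qed.

Lemma eps_transitive x : x != 0 -> exists g, eps *m GLval g = x.
Proof.
move=> /rV0Pn[i0 xi]; have [g [e _ _]] := GL_move_row ord_max xi.
by exists (g^-1)%g; rewrite /Defs.eps -e GL_VxE mulmxK ?GLval_unitmx.
Qed.

Lemma ind_shift g x : eps *m GLval g = x ->
  (fun y => ind eps (y *m invmx (GLval g))) =1 ind x.
Proof.
move=> <- y; rewrite /ind; congr (nat_of_bool _)%:R; apply/eqP/eqP => [<-|->].
  by rewrite mulmxKV ?GLval_unitmx.
by rewrite mulmxK ?GLval_unitmx.
Qed.

Definition mirabolic p := forall j, GLval p ord_max j = (ord_max == j)%:R.

Lemma eps_mirabolic p : mirabolic p <-> eps *m GLval p = eps.
Proof.
rewrite /Defs.eps -rowE; split=> [hp|/rowP e j].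
  by apply/rowP=> j; rewrite !mxE hp eq_sym.
by have := e j; rewrite !mxE eq_sym.
Qed.

Lemma mirabolic_fun_op p : mirabolic p -> rdouble p *m fun_op (ind eps) = fun_op (ind eps).
Proof.
move/eps_mirabolic => ep; rewrite mulmx_sumr [RHS](reindex_inj (mulgI p)).
by apply: eq_bigr => g _; rewrite -scalemxAr rdoubleM GL_MxE mulmxA ep.
Qed.

(** Up to a scalar, the projection onto the Shalika vectors for the mirabolic. *)
Definition shalika_op := shear_proj *m fun_op (ind eps).

(** [shalika_op *m u] is a Shalika vector for the mirabolic, and its Whittaker
    projection is proportional to the number that is assumed to vanish. *)
Lemma shalika_op_kernel (ell : 'rV[C]_d) (u : 'cV[C]_d) : ell != 0 ->
  whittaker_functional rho psi ell ->
  ell *m rho sg *m shalika_op *m u = 0 -> shalika_op *m u = 0.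
Proof.
move=> nz w0 e.
have [v0 Ev] := @whittaker_proj_rank1 R F psi hpsi hpsi1 (k + k.+1) d rho rho_irr ell nz w0.
apply: (shalika_vector_eq0 hpsi hpsi1 rho_cusp).
- move=> X; rewrite mulmxA /shalika_op mulmxA -/(rshear X) shear_projMl.
  by rewrite -!scalemxAl.
- move=> p hp; rewrite mulmxA /shalika_op mulmxA -/(rdouble p) rdouble_shear_proj.
  by rewrite -(mulmxA _ (rdouble p)) mirabolic_fun_op.
- by rewrite Ev -mulmxA (mulmxA ell) (mulmxA _ shalika_op) e mulmx0.
Qed.

Lemma shalika_op_rowspace (ell : 'rV[C]_d) : ell != 0 -> whittaker_functional rho psi ell ->
  (shalika_op <= ell *m rho sg *m shalika_op)%MS.
Proof.
move=> nz w0; rewrite submxE; set B := _ *m shalika_op.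
apply/eqP/matrixP => i j.
have : shalika_op *m (cokermx B *m delta_mx j 0 : 'cV_d) = 0.
  by apply: (shalika_op_kernel nz w0); rewrite mulmxA mulmx_coker mul0mx.
by rewrite mulmxA -colE => /colP/(_ i); rewrite !mxE.
Qed.

Lemma card_field_neq0 : #|F|%:R != 0 :> C.
Proof. by rewrite pnatr_eq0 -lt0n (cardD1 0). Qed.

(** Such a functional is in the row space of the projection [shalika_op], all of
    whose rows are multiples of a single one by the kernel computation above. *)
Lemma shalika_functional_unique (ell y : 'rV[C]_d) : ell != 0 ->
  whittaker_functional rho psi ell ->
  (forall X, y *m rshear X = psi (\tr X) *: y) ->
  (forall p, mirabolic p -> y *m rdouble p = y) ->
  exists c, y = c *: (ell *m rho sg *m shalika_op).
Proof.
move=> nz w0 hX hp; apply/sub_rVP.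
have yA : y *m shear_proj = #|{: 'M[F]_m}|%:R *: y.
  rewrite mulmx_sumr (eq_bigr (fun=> y)) => [|X _].
    by rewrite sumr_const -scaler_nat.
  by rewrite -scalemxAr hX scalerA -(addcharD hpsi) addNr (addchar0 hpsi) scale1r.
pose P := [pred g : {'GL_m[F]} | eps *m GLval g == eps].
have yD : y *m fun_op (ind eps) = #|P|%:R *: y.
  rewrite mulmx_sumr (bigID P) /= [X in _ + X]big1 ?addr0 => [|g /negPf h].
    rewrite (eq_bigr (fun=> y)) => [|g /eqP h]; first by rewrite sumr_const -scaler_nat.
    by rewrite -scalemxAr /ind h eqxx scale1r hp //; apply/eps_mirabolic.
  by rewrite -scalemxAr /ind h scale0r.
have P0 : #|P|%:R != 0 :> C.
  by rewrite pnatr_eq0 -lt0n (cardD1 1%g) inE GL_1E mulmx1 eqxx.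
have M0 : #|{: 'M[F]_m}|%:R != 0 :> C.
  by rewrite card_mx natrX expf_neq0 // card_field_neq0.
have -> : y = (#|{: 'M[F]_m}|%:R * #|P|%:R)^-1 *: (y *m shalika_op).
  by rewrite /shalika_op mulmxA yA -scalemxAl yD !scalerA mulVf ?scale1r ?mulf_neq0.
by rewrite scalemx_sub // (submx_trans (submxMl _ _)) // shalika_op_rowspace.
Qed.

Definition fourier_const : C := (#|F|%:R `^ (- (m%:R / 2)))%:C.
Local Notation kappa := fourier_const.

Lemma fourierE phi y :
  fourier psi phi y = kappa * \sum_x phi x * psi ((x *m y^T) 0 0).
Proof. by []. Qed.

Lemma fourier_ind0 y : fourier psi (ind 0) y = kappa.
Proof.
rewrite fourierE -[RHS]mulr1; congr (_ * _).
rewrite (bigD1 0) //= big1 => [|x x0]; last by rewrite /ind (negPf x0) mul0r.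
by rewrite /ind eqxx mul0mx mxE (addchar0 hpsi) mulr1 addr0.
Qed.

Lemma fourier_sum phi y : fourier psi phi y = \sum_x phi x * fourier psi (ind x) y.
Proof.
rewrite fourierE mulr_sumr; apply: eq_bigr => x _.
rewrite fourierE mulrCA; congr (_ * (_ * _)).
rewrite (bigD1 x) //= big1 ?addr0 => [|z zx]; first by rewrite /ind eqxx mul1r.
by rewrite /ind (negPf zx) mul0r.
Qed.

Lemma fourier1 y : fourier psi (fun=> 1) y = kappa * ((y == 0)%:R * #|F|%:R ^+ m).
Proof.
rewrite fourierE; congr (_ * _); under eq_bigr do rewrite mul1r.
rewrite (sum_addchar_row hpsi hpsi1).
congr (_ * _).
by rewrite -[in RHS](inj_eq (@trmx_inj _ _ _)) trmx0.
Qed.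

Lemma fourier_at0 phi : fourier psi phi 0 = kappa * \sum_x phi x.
Proof.
rewrite fourierE; congr (_ * _); apply: eq_bigr => x _.
by rewrite trmx0 mulmx0 mxE (addchar0 hpsi) mulr1.
Qed.

Lemma fourier_shift phi h y : fourier psi phi (y *m (GLval h)^T) =
  fourier psi (fun x => phi (x *m invmx (GLval h))) y.
Proof.
rewrite !fourierE; congr (_ * _).
rewrite [RHS](reindex_inj (can_inj (mulmxK (GLval_unitmx h)))) /=.
by apply: eq_bigr => x _; rewrite mulmxK ?GLval_unitmx // trmx_mul trmxK mulmxA.
Qed.

Variable ell : 'rV[C]_d.
Hypothesis ell0 : ell != 0.
Hypothesis ell_whit : whittaker_functional rho psi ell.

(** The two forms up to the common factor [JS_const], as functionals of the vector
    that defines the Whittaker function. *)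
Definition shalika_row : 'rV[C]_d := ell *m rho sg *m shear_proj.
Definition JSrow phi := shalika_row *m fun_op phi.
Definition JSdual_row phi := shalika_row *m dual_fun_op (fourier psi phi).
Local Notation base_row := (ell *m rho sg *m shalika_op).

Lemma JSrow_eps : base_row = JSrow (ind eps).
Proof. by rewrite /JSrow /shalika_row /shalika_op !mulmxA. Qed.

Lemma shalika_row_rshear g X :
  shalika_row *m rdouble g *m rshear X = psi (\tr X) *: (shalika_row *m rdouble g).
Proof.
rewrite -mulmxA rdouble_rshear mulmxA /shalika_row -(mulmxA _ shear_proj).
by rewrite shear_projMr tr_conjM -scalemxAr -scalemxAl.
Qed.

Lemma JSrow_rshear phi X : JSrow phi *m rshear X = psi (\tr X) *: JSrow phi.
Proof.
rewrite /JSrow mulmx_sumr mulmx_suml scaler_sumr; apply: eq_bigr => g _.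
by rewrite -scalemxAr -scalemxAl shalika_row_rshear !scalerA mulrC.
Qed.

Lemma JSdual_row_rshear phi X :
  JSdual_row phi *m rshear X = psi (\tr X) *: JSdual_row phi.
Proof.
rewrite /JSdual_row mulmx_sumr mulmx_suml scaler_sumr; apply: eq_bigr => g _.
by rewrite -scalemxAr -scalemxAl shalika_row_rshear !scalerA mulrC.
Qed.

Lemma JSrow_rdouble phi h :
  JSrow phi *m rdouble h = JSrow (fun x => phi (x *m invmx (GLval h))).
Proof. by rewrite /JSrow -mulmxA fun_op_rdouble. Qed.

Lemma JSdual_row_rdouble phi h :
  JSdual_row phi *m rdouble h = JSdual_row (fun x => phi (x *m invmx (GLval h))).
Proof.
rewrite /JSdual_row -mulmxA dual_fun_op_rdouble; congr (_ *m _).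
by apply: eq_dual_fun_op => y; rewrite fourier_shift.
Qed.

Lemma eq_JSrow phi phi' : phi =1 phi' -> JSrow phi = JSrow phi'.
Proof. by move=> e; rewrite /JSrow (eq_fun_op e). Qed.

Lemma eq_fourier phi phi' : phi =1 phi' -> fourier psi phi =1 fourier psi phi'.
Proof.
by move=> e y; rewrite !fourierE; congr (_ * _); apply: eq_bigr => x _; rewrite e.
Qed.

Lemma eq_JSdual_row phi phi' : phi =1 phi' -> JSdual_row phi = JSdual_row phi'.
Proof. by move=> e; rewrite /JSdual_row (eq_dual_fun_op (eq_fourier e)). Qed.

Lemma JSrow_sum phi : JSrow phi = \sum_x phi x *: JSrow (ind x).
Proof.
rewrite /JSrow [in LHS]fun_op_sum mulmx_sumr; apply: eq_bigr => x _.
by rewrite -scalemxAr.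
Qed.

Lemma JSdual_row_sum phi : JSdual_row phi = \sum_x phi x *: JSdual_row (ind x).
Proof.
rewrite {1}/JSdual_row (eq_dual_fun_op (fourier_sum phi)).
rewrite [RHS](eq_bigr (fun x =>
   shalika_row *m (phi x *: dual_fun_op (fourier psi (ind x))))) => [|x _]; last first.
  by rewrite -scalemxAr.
rewrite -mulmx_sumr; congr (_ *m _).
under [RHS]eq_bigr do rewrite scaler_sumr; rewrite exchange_big /=.
apply: eq_bigr => g _; rewrite scaler_suml; apply: eq_bigr => x _.
by rewrite scalerA.
Qed.

Lemma JSrow_ind0 : JSrow (ind 0) = 0.
Proof. by rewrite /JSrow fun_op_ind0 mulmx0. Qed.

(** The Fourier transform of a point mass at zero is constant, and on constants
    the two operators agree. *)
Lemma JSdual_row_ind0 : JSdual_row (ind 0) = kappa *: JSrow (fun=> 1).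
Proof.
rewrite /JSdual_row (eq_dual_fun_op fourier_ind0) /JSrow scalemxAr; congr (_ *m _).
by rewrite scaler_sumr; apply: eq_bigr => g _; rewrite scale1r.
Qed.

(** The Fourier transform of a constant is supported at zero, which the orbit
    avoids. *)
Lemma JSdual_row1 : JSdual_row (fun=> 1) = 0.
Proof.
rewrite /JSdual_row (eq_dual_fun_op fourier1) /dual_fun_op big1 ?mulmx0 // => g _.
by rewrite (negPf (eps_GL_neq0 _)) mul0r mulr0 scale0r.
Qed.

(** At the point mass at [eps] both forms give functionals on the same line; by
    equivariance their ratio is the same at every nonzero point, and the point
    mass at zero has been computed. *)
Lemma JSdual_row_decomp : exists c, forall phi,
  JSdual_row phi = c *: JSrow phi + (phi 0 * kappa) *: JSrow (fun=> 1).
Proof.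
have [|p hp|c hc] := @shalika_functional_unique ell (JSdual_row (ind eps)) ell0 ell_whit.
- exact: JSdual_row_rshear.
- rewrite JSdual_row_rdouble; apply: eq_JSdual_row.
  by apply: ind_shift; apply/eps_mirabolic.
exists c => phi; rewrite JSdual_row_sum [X in c *: X]JSrow_sum.
rewrite (bigD1 0) //= [X in c *: X](bigD1 0) //= JSrow_ind0 scaler0 add0r.
rewrite JSdual_row_ind0 scalerA addrC; congr (_ + _).
rewrite scaler_sumr; apply: eq_bigr => x x0.
have [g eg] := eps_transitive x0.
rewrite -(eq_JSdual_row (ind_shift eg)) -(eq_JSrow (ind_shift eg)).
rewrite -JSdual_row_rdouble -JSrow_rdouble -JSrow_eps hc -scalemxAl.
by rewrite !scalerA mulrC.
Qed.

Lemma JSrow1_invariant h : JSrow (fun=> 1) *m rdouble h = JSrow (fun=> 1).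
Proof. by rewrite JSrow_rdouble. Qed.

(** A nonzero [JSrow (fun=> 1)] spans the line of Shalika functionals for the
    mirabolic. Being invariant under the whole Levi subgroup, it makes every
    functional on the line so, and the values at the nonzero points agree. *)
Lemma JSrow_degenerate : JSrow (fun=> 1) != 0 ->
  forall phi, JSrow phi = (\sum_(x | x != 0) phi x) *: base_row.
Proof.
move=> nz.
have [|p hp|c hc] := @shalika_functional_unique ell (JSrow (fun=> 1)) ell0 ell_whit.
- exact: JSrow_rshear.
- exact: JSrow1_invariant.
have c0 : c != 0 by apply: contraNneq nz => c0; rewrite hc c0 scale0r.
have inv h : base_row *m rdouble h = base_row.
  by apply: (scalerI c0); rewrite scalemxAl -hc JSrow1_invariant.
move=> phi; rewrite JSrow_sum (bigD1 0) //= JSrow_ind0 scaler0 add0r scaler_suml.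
apply: eq_bigr => x x0; have [g eg] := eps_transitive x0.
by rewrite -(eq_JSrow (ind_shift eg)) -JSrow_rdouble -JSrow_eps inv.
Qed.

Lemma sum_nz1 : \sum_(x : 'rV[F]_m | x != 0) 1 = #|F|%:R ^+ m - 1 :> C.
Proof.
have : \sum_(x : 'rV[F]_m) (1 : C) = #|F|%:R ^+ m.
  by rewrite sumr_const card_mx mul1n natrX.
by rewrite (bigD1 0) //= => <-; rewrite addrAC subrr add0r.
Qed.

(** The constant of [JSdual_row_decomp] is found by evaluating at a constant test
    function, where the dual form vanishes. *)
Lemma JSdual_row_degenerate : JSrow (fun=> 1) != 0 -> forall phi,
  JSdual_row phi = (kappa * (phi 0 * (#|F|%:R ^+ m - 1) - \sum_(x | x != 0) phi x)) *: base_row.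
Proof.
move=> nz phi; have [c hc] := JSdual_row_decomp.
have e := JSrow_degenerate nz.
have e1 : JSrow (fun=> 1) = (#|F|%:R ^+ m - 1) *: base_row by rewrite e sum_nz1.
have Q0 : #|F|%:R ^+ m - 1 != 0 :> C.
  by apply: contraNneq nz => Q0; rewrite e1 Q0 scale0r.
have cE : c = - kappa.
  have := JSdual_row1; rewrite hc mul1r -scalerDl => /eqP.
  by rewrite scaler_eq0 (negPf nz) orbF addr_eq0 => /eqP.
rewrite hc cE e1 e !scalerA -scalerDl; congr (_ *: _); ring.
Qed.

End ShalikaForms.

(** * Complex powers and values of rational functions *)

Section ComplexPowers.
Variable R : realType.
Implicit Types (a : R) (s t : R[i]).

Lemma cpowD a s t : 0 < a -> cpow a (s + t) = cpow a s * cpow a t.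
Proof.
move=> a0; case: s => x y; case: t => x' y'; rewrite /cpow /=.
rewrite powRD; last by apply/implyP => _; rewrite gt_eqF.
rewrite mulrDl cosD sinD; apply/eqP; rewrite eq_complex /=; apply/andP; split; apply/eqP; ring.
Qed.

Lemma cpow0 a : cpow a 0 = 1.
Proof.
rewrite /cpow /= powRr0 mul0r cos0 sin0.
by rewrite mul1r.
Qed.

Lemma cpow1 a : 0 < a -> cpow a 1 = a%:C.
Proof.
by move=> a0; rewrite /cpow /= powRr1 ?ltW // mul0r cos0 sin0 mulr1.
Qed.

Lemma cpowM_nat a n s : 0 < a -> cpow a (n%:R * s) = cpow a s ^+ n.
Proof.
move=> a0; elim: n => [|n IH]; first by rewrite mul0r cpow0.
by rewrite -natr1 mulrDl mul1r cpowD // IH exprSr.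
Qed.

End ComplexPowers.

Lemma ratfun_value_uniq (R : realType) (f : {fraction {poly R[i]}}) (A B : {poly R[i]})
    (z v : R[i]) :
  f * tofrac B = tofrac A -> ratfun_value f z v -> v * B.[z] = A.[z].
Proof.
move=> fAB [a [b [bz fab ->]]].
have b0 : b != 0 by apply: contraNneq bz => ->; rewrite horner0.
have tb0 : tofrac b != 0 by rewrite tofrac_eq0.
have : a * B = A * b.
  by apply/eqP; rewrite -tofrac_eq !tofracM -fAB fab mulrAC divfK.
move/(congr1 (fun p => p.[z])); rewrite !hornerM => e.
by rewrite mulrAC e mulfK.
Qed.

(** * The gamma factor *)

Section Rows.
Variables (R : realType) (F : finFieldType) (psi : F -> R[i]).
Hypotheses (hpsi : is_addchar psi) (hpsi1 : nontrivial_char psi).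
Variables (k d : nat).
Local Notation m := k.+1.
Local Notation C := R[i].
Variable rho : mx_representation C 'GL_(k.+1 + k.+1)[F] d.
Local Notation sg := (sigmaGL F k).
Local Notation GL := {'GL_(m + m)[F]}.
Variables (ell : 'rV[C]_d) (v : 'cV[C]_d) (W : GL -> C).
Hypothesis ell_whit : whittaker_functional rho psi ell.
Hypothesis WE : forall g, W g = (ell *m (rho g *m v)) 0 0.

Lemma whittaker_model_equiv (u g : GL) : u \in unip F (m + m) ->
  W (u * g)%g = psi (superdiag_sum u) * W g.
Proof.
move=> un; rewrite !WE -(ell_whit un) (_ : rho (u * g)%g = rho u *m rho g).
  by rewrite !mulmxA.
exact: (@repGLM R F (k + k.+1) d rho u g).
Qed.

(** Both unfolded sums have this shape, with [c] the value of a test function. *)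
Lemma shalika_sumE (c : {'GL_m[F]} -> C) :
  \sum_(g : {'GL_m[F]}) \sum_X W (sg * shearGL X * doubleGL g)%g * psi (- \tr X) * c g
  = (shalika_row psi rho ell *m (\sum_g c g *: rdouble rho g) *m v) 0 0.
Proof.
rewrite mulmx_sumr mulmx_suml summxE; apply: eq_bigr => g _.
rewrite /shalika_row /shear_proj mulmx_sumr !mulmx_suml summxE; apply: eq_bigr => X _.
rewrite WE.
have -> : rho (sg * shearGL X * doubleGL g)%g = rho sg *m rshear rho X *m rdouble rho g.
  rewrite /rshear /rdouble -(@repGLM R F (k + k.+1) d rho sg (shearGL X)).
  exact: (@repGLM R F (k + k.+1) d rho (sg * shearGL X)%g (doubleGL g)).
rewrite -!scalemxAr -!scalemxAl !scalerA [RHS]mxE !mulmxA; ring.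
Qed.

Lemma JS_rowE phi : JS psi W phi =
  JS_const R F k * (JSrow psi rho ell phi *m v) 0 0.
Proof.
rewrite JS_unfold //; last exact: whittaker_model_equiv.
by rewrite shalika_sumE.
Qed.

Lemma JSdual_rowE phi : JSdual psi W phi =
  JS_const R F k * (JSdual_row psi rho ell phi *m v) 0 0.
Proof.
rewrite JSdual_unfold //; last exact: whittaker_model_equiv.
by rewrite shalika_sumE.
Qed.

End Rows.

Theorem theorem3p15 (R : realType) (F : finFieldType) (psi0 : F -> R[i])
    (hpsi : is_addchar psi0) (hpsi1 : nontrivial_char psi0)
    (k d : nat) (pi0 : mx_representation R[i] 'GL_(k.+1 + k.+1)[F] d)
    (hirr : mx_irreducible pi0) (hcusp : cuspidal pi0) :
  let q : R := #|F|%:R in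
  let m : R[i] := k.+1%:R in
  exists gamma : {fraction {poly R[i]}},
    forall (W0 : {'GL_(k.+1 + k.+1)[F]} -> R[i]) (phi0 : 'rV[F]_k.+1 -> R[i]),
      whittaker_model pi0 psi0 W0 ->
    forall s gamma_s : R[i],
      ratfun_value gamma (cpow q (- s)) gamma_s ->
      cpow q (- (m * s)) != 1 ->
      cpow q (- (m * (1 - s))) != 1 ->
      JSdual psi0 W0 phi0
      + cpow q (- (m * (1 - s))) * fourier psi0 phi0 0
        * Lfactor #|F| (m * (1 - s)) * JS psi0 W0 (fun=> 1)
      = gamma_s
        * (JS psi0 W0 phi0
           + cpow q (- (m * s)) * phi0 0
             * Lfactor #|F| (m * s) * JS psi0 W0 (fun=> 1)).
Proof.
move=> q m.
have q0 : 0 < q by rewrite ltr0n (cardD1 0).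
pose E := @whittaker_proj R F psi0 (k + k.+1) d pi0.
have [E0|] := eqVneq E 0.
  exists 0 => W phi [ell [v [nz w0 _]]]; case/negP: nz.
  have /(@whittaker_functional_proj R F psi0 hpsi (k + k.+1)) e := w0.
  by rewrite -e -/E E0 mulmx0.
case/(whittaker_functional_exists hpsi) => ell0 nz0 w0.
pose kap := fourier_const R F k.
pose Q : R[i] := #|F|%:R ^+ k.+1.
have [c hc] := JSdual_row_decomp hpsi hpsi1 hirr hcusp nz0 w0.
have model W : whittaker_model pi0 psi0 W -> exists a (v : 'cV[R[i]]_d), forall phi,
   JS psi0 W phi = a * (JSrow psi0 pi0 ell0 phi *m v) 0 0 /\
   JSdual psi0 W phi = a * (JSdual_row psi0 pi0 ell0 phi *m v) 0 0.
  case=> ell [v [nz w WE]].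
  have [a ea] := whittaker_unique (n := (k + k.+1)%N) hpsi hpsi1 hirr nz0 w0 w.
  exists (JS_const R F k * a), v => phi.
  rewrite (JS_rowE hpsi w WE) (JSdual_rowE hpsi w WE) /JSrow /JSdual_row /shalika_row ea.
  by rewrite -!scalemxAl -!mulrA; split; congr (_ * _); rewrite mxE.
have [l0|lnz] := eqVneq (JSrow psi0 pi0 ell0 (fun=> 1)) 0.
  (* No Shalika functional: the correction terms vanish and [c] is the factor. *)
  exists (tofrac c%:P) => W phi /model[a [v av]] s gs hg _ _.
  have -> : gs = c.
    have e : tofrac c%:P * tofrac 1%:P = tofrac c%:P by rewrite polyC1 tofrac1 mulr1.
    by have := ratfun_value_uniq e hg; rewrite !hornerC mulr1.
  have [-> ->] := av phi; have [-> _] := av (fun=> 1).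
  have z0 : ((0 : 'rV[R[i]]_d) *m v) 0 0 = 0 by rewrite mul0mx mxE.
  rewrite hc l0 scaler0 addr0 z0 !mulr0 !addr0 -scalemxAl [in LHS]mxE.
  by rewrite mulrCA.
(* With [t = q^(-ms)] the factor is [q^(m/2) (1 - t) / (q^m t - 1)]; here
   [kap = q^(-m/2)] and [Q = q^m], and ['X^(k.+1)] takes the value [t] at
   [q^(-s)]. It is found by comparing the coefficients of [phi 0] and of the sum
   of the other values of [phi]; the two conditions agree. *)
pose A : {poly R[i]} := (kap * Q) *: (1 - 'X^(k.+1)).
pose B : {poly R[i]} := Q *: 'X^(k.+1) - 1.
exists (tofrac A / tofrac B) => W phi /model[a [v av]] s gs hg.
have Q0 : Q != 0 by rewrite expf_neq0 // card_field_neq0.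
have B0 : B != 0.
  apply/eqP => /(congr1 (fun p : {poly R[i]} => p.[0])); rewrite /B !hornerE.
  by rewrite expr0n mulr0 sub0r => /eqP; rewrite oppr_eq0 oner_eq0.
have e : tofrac A / tofrac B * tofrac B = tofrac A by rewrite divfK ?tofrac_eq0.
have gE := ratfun_value_uniq e hg; rewrite /A /B !hornerE in gE.
set z := cpow q (- s) in gE *.
have tE : cpow q (- (m * s)) = z ^+ k.+1 by rewrite -mulrN cpowM_nat.
have dE : cpow q (- (m * (1 - s))) * (Q * z ^+ k.+1) = 1.
  have -> : Q = cpow q m.
    rewrite -[m]mulr1 cpowM_nat // cpow1 //.
    by rewrite /Q /q; elim: k.+1 => // r IH; rewrite !exprS IH // rmorph_nat.
  by rewrite -tE -!cpowD // (_ : _ + _ = 0) ?cpow0 //; ring.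
rewrite /Lfactor tE -/q.
set t := z ^+ k.+1 in dE gE *; set t' := cpow q (- (m * (1 - s))) in dE *.
move=> t1 t'1.
have [-> ->] := av phi; have [-> _] := av (fun=> 1).
have deg := JSrow_degenerate hpsi hpsi1 hirr hcusp nz0 w0 lnz.
rewrite (JSdual_row_degenerate hpsi hpsi1 hirr hcusp nz0 w0 lnz) !deg sum_nz1 fourier_at0 //.
rewrite -/kap -/Q -!scalemxAl.
set L := (_ *m v : 'M_1).
have sE (b : R[i]) : (b *: L) 0 0 = b * L 0 0 by rewrite mxE.
rewrite !sE; move: (L 0 0) => l.
have -> : \sum_x phi x = phi 0 + \sum_(x | x != 0) phi x by rewrite (bigD1 0).
move: (\sum_(x | x != 0) phi x) => S.
move: (phi 0) => p0.
have t1' : 1 - t != 0 by rewrite subr_eq0 eq_sym.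
have Qt0 : Q * t != 0.
  by apply/eqP => e0; move/eqP: dE; rewrite e0 mulr0 eq_sym oner_eq0.
have t'E : t' = (Q * t)^-1 by apply: (mulIf Qt0); rewrite dE mulVf.
have Qt1 : Q * t - 1 != 0.
  by rewrite subr_eq0; apply: contraNneq t'1 => e1; rewrite t'E e1 invr1.
have gE' : gs = kap * Q * (1 - t) / (Q * t - 1).
  by apply: (mulIf Qt1); rewrite gE divfK.
rewrite gE' t'E.
have q1 : 1 - (Q * t)^-1 = (Q * t - 1) / (Q * t) by rewrite mulrBl divff // mul1r.
rewrite q1; move: Q t Q0 t1' Qt0 Qt1 {gE dE tE t1 t'1 gE' t'E q1 e A B hg B0}.
move=> {}Q {}t Q0 t1' Qt0 Qt1.
by field; rewrite t1' Qt1 Q0 andbT; apply: contraNneq Qt0 => ->; rewrite mulr0.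
Qed.
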